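(* Let $N\ge1$. Each $\mathcal{R}$-class of the Okada monoid $\mathsf{O}_N$ contains a unique involutive element. Each $\mathcal{J}$-class of $\mathsf{O}_N$ contains a unique free element. Moreover, the free representative of (the $\mathcal{J}$-class of) $\mathbf{e}\in\mathsf{O}_N$ is the free element having the same propagating label set as $\mathbf{e}$.
   Context: Okada arc-diagrams. Write $[N]=\{1,\dots,N\}$, $\overline a=-a$, $|\overline a|=a$. The node set $V_N=[N]\cup\{\overline N,\dots,\overline1\}$ is ordered by $1<\dots<N<\overline N<\dots<\overline1$. A rank $N$ non-crossing arc-diagram is a perfect matching of $V_N$ into arcs $\{a,b\}$ ($a<b$) with no two arcs $\{a,b\},\{c,d\}$ satisfying $a<c<b<d$. $\{a,b\}$ is nested in $\{c,d\}$ if $c<a<b<d$. A rank $N$ Okada arc-diagram has in addition integer labels ${\bf h}$ on arcs with (1) $1\le{\bf h}(\{a,b\})\le\min(|a|,|b|)$; (2) ${\bf h}(\{a,b\})\equiv\min(|a|,|b|)\pmod2$; (3) ${\bf h}(\{a,b\})>{\bf h}(\{c,d\})$ if $\{a,b\}$ is nested in $\{c,d\}$. $\mathfrak{A}_N$ is the set of these. An arc is propagating if it joins a node of $[N]$ to an overlined node. The mirror $D^\star$ is obtained by exchanging $a\leftrightarrow\overline a$ for all $a$, keeping labels. Monoid. For $C,D\in\mathfrak{A}_N$, the product $CD=[C\circ D]$ is obtained by identifying the node $\overline a$ of $C$ with the node $a$ of $D$ for all $a$, concatenating arcs, giving each resulting arc the minimum of the labels of the arcs composing it, and removing closed loops.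 This makes $\mathfrak{A}_N$ a monoid with unit the diagram with arcs $\{a,\overline a\}$ of label $a$. Let $\mathsf{G}_i$ ($1\le i<N$) be the diagram with arcs $\{j,\overline j\}$ of label $j$ for $j\ne i,i+1$, and $\{i,i+1\}$, $\{\overline i,\overline{i+1}\}$ of label $i$. The Okada monoid $\mathsf{O}_N$ is the monoid generated by $\mathsf{E}_1,\dots,\mathsf{E}_{N-1}$ with relations $\mathsf{E}_i^2=\mathsf{E}_i$; $\mathsf{E}_i\mathsf{E}_j=\mathsf{E}_j\mathsf{E}_i$ for $|i-j|\ge2$; $\mathsf{E}_{i+1}\mathsf{E}_i\mathsf{E}_{i+1}=\mathsf{E}_{i+1}$. It is identified with $\mathfrak{A}_N$ via the isomorphism $\mathsf{E}_i\mapsto\mathsf{G}_i$. The propagating label set $\mathrm{PLab}(\mathbf e)$ of $\mathbf e\in\mathfrak{A}_N$ is the set of labels of its propagating arcs; it is a Fibonacci set of rank $N$, i.e. a subset $\{s_1<\dots<s_k\}$ of $[N]$ with $k\equiv N\pmod2$ and $s_\ell\equiv\ell\pmod2$ for all $\ell$. An element $\mathbf e$ is involutive if $\mathbf e=\mathbf e^\star$. For a Fibonacci set $S$ of rank $N$ put $\mathfrak{F}(S)=\{i\in[N]\mid i-\max\{s\in S\cup\{0\}\mid s\le i\}\text{ is odd}\}$ (a subset of $[N-1]$ containing no two consecutive integers); the free element associated to $S$ is $\mathsf{E}_S=\prod_{i\in\mathfrak{F}(S)}\mathsf{E}_i$ (commuting factors), and an element is free if it equals $\mathsf{E}_S$ for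 some $S$. Green relations: $\mathbf e\,\mathcal{R}\,\mathbf f$ (resp. $\mathbf e\,\mathcal{J}\,\mathbf f$) iff $\mathbf e$ and $\mathbf f$ generate the same right (resp. two-sided) ideal of the monoid. *)

(* Defs.v *)
From mathcomp Require Import all_boot.

Set Implicit Arguments.
Unset Strict Implicit.
Unset Printing Implicit Defensive.

(** Nodes.  [(false, i)] is the node [i + 1] and [(true, i)] the overlined node
    [i + 1]; [nabs] is the absolute value, so it ranges over 1..N. *)

Definition node (N : nat) : finType := (bool * 'I_N)%type.

Definition overlined N (x : node N) : bool := x.1.

Definition nabs N (x : node N) : nat := (x.2 : nat).+1.

Definition bar N (x : node N) : node N := (~~ x.1, x.2).

(** Position (from 0) in the order 1 < ... < N < bar N < ... < bar 1. *)
Definition pos N (x : node N) : nat :=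
  if overlined x then N.*2 - nabs x else (nabs x).-1.

(** A labelled matching is given by the map sending a node to the other end of
    its arc, and by the map sending a node to the label of its arc.  [diag] is
    the raw data; the Okada arc-diagrams are cut out by [is_okada]. *)

Definition diag (N : nat) : Type :=
  ({ffun node N -> node N} * {ffun node N -> nat})%type.

Definition mate N (D : diag N) (x : node N) : node N := D.1 x.
Definition label N (D : diag N) (x : node N) : nat := D.2 x.

Definition is_matching N (D : diag N) : Prop :=
  forall x, mate D x <> x /\ mate D (mate D x) = x.

(** Only [a] and [c] are quantified: the arcs are {a, mate a}, {c, mate c}, and
    the inequalities force [a], [c] to be their left ends. *)
Definition non_crossing N (D : diag N) : Prop :=
  forall a c, ~ [/\ pos a < pos c, pos c < pos (mate D a)
                  & pos (mate D a) < pos (mate D c)].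

Record is_okada N (D : diag N) : Prop := IsOkada {
  okada_matching : is_matching D;
  okada_non_crossing : non_crossing D;
  okada_label_arc : forall x, label D (mate D x) = label D x;
  okada_label_bound :
    forall x, 1 <= label D x <= minn (nabs x) (nabs (mate D x));
  okada_label_parity :
    forall x, label D x = minn (nabs x) (nabs (mate D x)) %[mod 2];
  okada_label_nested :
    forall a c, pos c < pos a -> pos a < pos (mate D a) ->
      pos (mate D a) < pos (mate D c) -> label D c < label D a
}.

Definition mirror N (D : diag N) : diag N :=
  ([ffun x => bar (mate D (bar x))], [ffun x => label D (bar x)]).

(** The stacking of [C] above [D]: the nodes of [C] are tagged by [inl], those
    of [D] by [inr]; edges are the arcs of [C], the arcs of [D], and the
    identifications of [bar a] in [C] with [a] in [D]. *)

Definition stack_node (N : nat) : finType := (node N + node N)%type.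

Definition stack_edge N (C D : diag N) : rel (stack_node N) :=
  fun u v => match u, v with
  | inl x, inl y => y == mate C x
  | inr x, inr y => y == mate D x
  | inl x, inr y | inr y, inl x =>
      [&& overlined x, ~~ overlined y & nabs x == nabs y]
  end.

Definition stack_label N (C D : diag N) (u : stack_node N) : nat :=
  match u with inl x => label C x | inr x => label D x end.

Definition outer N (x : node N) : stack_node N :=
  if overlined x then inr x else inl x.

(** The other end of the product arc through [x] is the other outer node in the
    connected component of [x]; its label is the minimum over that component.
    Components without outer nodes are the closed loops, and are dropped. *)
Definition okada_mul N (C D : diag N) : diag N :=
  let joined := connect (stack_edge C D) in
  ([ffun x => odflt x [pick y | y != x & joined (outer x) (outer y)]],
   [ffun x => \big[minn/stack_label C D (outer x)]_(u | joined (outer x) u)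
                 stack_label C D u]).

Definition okada_one (N : nat) : diag N :=
  ([ffun x => bar x], [ffun x => nabs x]).

(** Meaningful for [1 <= i < N]; then [insubd x.2 k] is the ordinal of value
    [k], that is, the index of the node of absolute value [k + 1]. *)
Definition okada_gen (N i : nat) : diag N :=
  ([ffun x : node N =>
      if nabs x == i then (x.1, insubd x.2 i)
      else if nabs x == i.+1 then (x.1, insubd x.2 i.-1)
      else bar x],
   [ffun x : node N => if nabs x == i.+1 then i else nabs x]).

(** The Okada monoid is taken in its diagrammatic realization: its elements are
    the [D] with [is_okada D], its product is [okada_mul], and the generator
    [E_i] is [okada_gen N i]. *)

Definition right_ideal N (e x : diag N) : Prop :=
  exists2 y, is_okada y & x = okada_mul e y.

Definition two_sided_ideal N (e x : diag N) : Prop :=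
  exists y z, [/\ is_okada y, is_okada z & x = okada_mul (okada_mul y e) z].

Definition greenR N (e f : diag N) : Prop :=
  forall x, right_ideal e x <-> right_ideal f x.

Definition greenJ N (e f : diag N) : Prop :=
  forall x, two_sided_ideal e x <-> two_sided_ideal f x.

Definition involutive_diag N (e : diag N) : Prop := e = mirror e.

Definition propagating N (D : diag N) (x : node N) : bool :=
  overlined x != overlined (mate D x).

(** Labels are at most [N], so no label is lost by restricting to ['I_N.+1]. *)
Definition PLab N (e : diag N) : {set 'I_N.+1} :=
  [set l : 'I_N.+1 | [exists x, propagating e x && (label e x == l)]].

(** [enum S] is increasing: its entry of index [l] is s_(l+1). *)
Definition fibonacci_set N (S : {set 'I_N.+1}) : Prop :=
  [/\ ord0 \notin S,
      #|S| = N %[mod 2]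
    & forall l, l < #|S| -> nth ord0 (enum S) l = l.+1 %[mod 2]].

(** The empty maximum is 0, which accounts for the union with {0}. *)
Definition frakF N (S : {set 'I_N.+1}) : seq nat :=
  [seq i <- iota 1 N | odd (i - \max_(s in S | s <= i) s)].

Definition free_elt N (S : {set 'I_N.+1}) : diag N :=
  \big[@okada_mul N/okada_one N]_(i <- frakF S) okada_gen N i.

Definition is_free N (e : diag N) : Prop :=
  exists2 S : {set 'I_N.+1}, fibonacci_set S & e = free_elt S.

(* Main.v *)
Require Import Defs.
From mathcomp Require Import all_boot all_order zify.

(** Okada diagrams multiply by contraction: write the nodes of [C] and then
    those of [D] on a line; the middle nodes bar 1 of [C] and 1 of [D] are
    adjacent, gluing them leaves bar 2 and 2 adjacent, and so on.  A single
    contraction of two adjacent points preserves the three defining conditions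
    once the parity condition is read as: the label has the parity of the
    position of the left end.  Strict nesting of labels saves the parity.

    The labels of the propagating arcs are pairwise distinct, so they name these
    arcs, and two diagrams [e], [f] with the same propagating labels can be cut
    into halves and recombined into a diagram [e|f].  These recombinations
    multiply like a groupoid: [(e|f)(f*|g) = e|g].  Hence [e] is R-equivalent to
    the involutive [e|e*], and [PLab e = PLab f] implies that [e] and [f] are
    J-equivalent.  Conversely multiplication only removes propagating arcs and
    lowers their labels, so [PLab] is a J-invariant, and the free element of [S]
    has propagating label set [S]. *)

(** The product is defined by connected components and minima over them, whereas contraction is
    local. The gluing induction therefore carries two invariants side by side: [planar] for the
    combinatorics, [linked] for the agreement with the graph. The bound on labels is in neither; it
    is recovered at the end, because the minimum is taken over a component that contains the outer
    node itself. Associativity is obtained differently: both bracketings are read off one graph with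
    three storeys. Cutting and sewing works because whether a propagating arc covers a node depends
    only on what happens on the side of that node. For uniqueness in an R-class, right
    multiplication keeps the non-propagating arcs of the upper half and never raises its labels, and
    an involutive element is determined by its upper half. *)

Set Implicit Arguments.
Unset Strict Implicit.
Unset Printing Implicit Defensive.

(** * Contraction of a planar labelled matching *)

(** Serves twice: for the nodes strictly under an arc, and for the non-propagating nodes among the
    first [k]. Both sets are stable under [mate]. *)
Lemma card_involution_even (T : finType) (f : T -> T) (A : {set T}) :
  {in A, forall x, [/\ f x \in A, f x != x & f (f x) = x]} -> ~~ odd #|A|.
Proof.
have [n] := ubnP #|A|; elim: n A => // n IHn A ltAn fA.
have [->|[x xA]] := set_0Vmem A; first by rewrite cards0.
have [fxA fxx ffx] := fA x xA.
pose B := A :\ x :\ f x.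
have cardA : #|A| = #|B|.+2.
  by rewrite (cardsD1 x) xA (cardsD1 (f x) (A :\ x)) !inE fxx fxA.
rewrite cardA /= negbK; apply: IHn; first by move: ltAn; rewrite cardA; lia.
move=> y; rewrite !inE => /and3P[yfx yx yA]; have [fyA fyy ffy] := fA y yA.
split=> //; rewrite fyA andbT; apply/andP; split.
  by apply: contra_neq yx => fyx; rewrite -ffy fyx.
by apply: contra_neq yfx => <-.
Qed.

(** Symmetric in the two ends, so that arcs need no orientation and either end can represent its
    arc. *)
Definition between (a x b : nat) : bool := (a < x < b) || (b < x < a).

(* The ends of an arc of a non-crossing matching have positions of opposite
   parities, so [planar_parity] says the same thing at both ends: the label has
   the parity of the position, counted from 1, of the left end.  In this form
   the condition makes sense after gluing. *)
Record planar (T : finType) (A : {set T}) (P : T -> nat) (m : T -> T)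
    (l : T -> nat) : Prop := Planar {
  planar_inj : {in A &, injective P};
  planar_mate : {in A, forall u, m u \in A};
  planar_neq : {in A, forall u, m u != u};
  planar_invol : {in A, forall u, m (m u) = u};
  planar_label : {in A, forall u, l (m u) = l u};
  planar_cross : {in A &, forall a c, c != a -> c != m a ->
    between (P a) (P c) (P (m a)) = between (P a) (P (m c)) (P (m a))};
  planar_nest : {in A &, forall a c,
    between (P a) (P c) (P (m a)) -> l a < l c};
  planar_parity : {in A, forall u, odd (l u) = odd (P u + (P u < P (m u)))}
}.

Lemma betweenC a x b : between a x b = between b x a.
Proof. by rewrite /between orbC. Qed.

(** In this additive form the contributions of two glued points cancel, because every other point
    compares with both in the same way; crossing conditions become Boolean identities. *)
Lemma betweenE a x b : x != a -> x != b -> between a x b = (x < a) (+) (x < b).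
Proof.
by rewrite /between; case: (ltngtP x a); case: (ltngtP x b).
Qed.

Lemma between_irrl a b : between a a b = false.
Proof. by rewrite /between ltnn andbF. Qed.

Lemma between_irrr a b : between a b b = false.
Proof. by rewrite betweenC between_irrl. Qed.

Section Contraction.

Variables (T : finType) (A : {set T}) (P : T -> nat).
Variables (m : T -> T) (l : T -> nat).
Hypothesis Apl : planar A P m l.
Variables p q : T.
(** Positions are never renumbered. Points glued earlier leave a gap of even size, so what remains
    of being consecutive is opposite parity and equal comparison with all other remaining points. *)
Hypotheses (pA : p \in A) (qA : q \in A) (oddpq : odd (P q) = ~~ odd (P p)).
Hypothesis adjpq : {in A :\ p :\ q, forall u, (P u < P p) = (P u < P q)}.

Definition contract_mate u :=
  if m u == p then m q else if m u == q then m p else m u.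
Definition contract_label u :=
  if (m u == p) || (m u == q) then minn (l p) (l q) else l u.

Local Notation A' := (A :\ p :\ q).

(** If [p] and [q] are mates, gluing them closes a loop that simply disappears, and only [ContractO]
    can occur. *)
Variant contract_spec u : T -> nat -> Prop :=
| ContractP of u = m p & m p != q : contract_spec u (m q) (minn (l p) (l q))
| ContractQ of u = m q & m p != q : contract_spec u (m p) (minn (l p) (l q))
| ContractO of m u \in A' & u != m p & u != m q : contract_spec u (m u) (l u).

Lemma contractP u :
  u \in A' -> contract_spec u (contract_mate u) (contract_label u).
Proof.
rewrite !inE => /and3P[uq up uA]; rewrite /contract_mate /contract_label.
have mm := planar_invol Apl.
case: eqP => [mup|/eqP mup] /=.
  have def_u: u = m p by rewrite -mup mm.
  by constructor=> //; rewrite -def_u.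
case: eqP => [muq|/eqP muq] /=.
  have def_u: u = m q by rewrite -muq mm.
  by constructor=> //; apply: contra_neq up => mpq; rewrite def_u -mpq mm.
constructor; first by rewrite !inE muq mup (planar_mate Apl).
  by apply: contra_neq mup => ->; rewrite mm.
by apply: contra_neq muq => ->; rewrite mm.
Qed.

(* For parity, when both new ends lie on the same side of [p] and [q], one of
   the glued arcs is nested in the other, which has the smaller label and hence
   determines the new one; its parity is the right one. *)
Lemma planar_contract : planar A' P contract_mate contract_label.
Proof.
have mm := planar_invol Apl; have mA := planar_mate Apl.
have mN := planar_neq Apl; have lm := planar_label Apl.
have cross := planar_cross Apl; have nest := planar_nest Apl.
have subA : {subset A' <= A} by move=> u; rewrite !inE => /and3P[].
have npq : p != q by apply: contra_eq_neq oddpq => ->; case: odd.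
have Pneq u v : u \in A -> v \in A -> u != v -> P u != P v.
  by move=> uA vA; apply: contra_neq => /(planar_inj Apl uA vA).
have flip u v : u \in A -> v \in A -> u != v -> (P v < P u) = ~~ (P u < P v).
  by move=> uA vA uv; rewrite -leqNgt ltn_neqAle eq_sym Pneq.
have newA : m p != q -> [/\ m p \in A', m q \in A' & m p != m q].
  move=> mpq; rewrite !inE mpq !mA // !mN // !andbT; split=> //.
    by apply: contra_neq mpq => <-; rewrite mm.
  by apply: contra_neq npq => e; rewrite -(mm p) // e mm.
have oth u : u \in A' ->
    [/\ u \in A, u != p, u != q & (P u < P p) = (P u < P q)].
  by move=> uA'; move: (uA'); rewrite !inE => /and3P[uq up uA]; rewrite adjpq.
(* The exclusive or of the crossing conditions of the two glued arcs, in which [p] and [q]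
   cancel. *)
have crossN c : m p != q -> c \in A' -> m c \in A' -> c != m p -> c != m q ->
    between (P (m p)) (P c) (P (m q)) = between (P (m p)) (P (m c)) (P (m q)).
  move=> mpq cA' mcA' cx cy; have [cA cp cq adjc] := oth c cA'.
  have [mcA mcp mcq adjmc] := oth _ mcA'.
  have mcx : m c != m p by apply: contra_neq cp => e; rewrite -(mm c) // e mm.
  have mcy : m c != m q by apply: contra_neq cq => e; rewrite -(mm c) // e mm.
  have := cross p c pA cA cp cx; have := cross q c qA cA cq cy.
  rewrite !betweenE ?Pneq ?mA // adjc adjmc.
  by do 6!case: (_ < _).
(* An old arc cannot separate [p] from [q], hence neither separates their mates. *)
have crossO a : m p != q -> a \in A' -> m a \in A' -> a != m p -> a != m q ->
    between (P a) (P (m p)) (P (m a)) = between (P a) (P (m q)) (P (m a)).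
  move=> mpq aA' maA' ax ay; have [aA ap aq adja] := oth a aA'.
  have [maA map maq adjma] := oth _ maA'.
  have pa : p != m a by rewrite eq_sym.
  have qa : q != m a by rewrite eq_sym.
  rewrite -(cross a p) // 1?eq_sym // -(cross a q) // 1?eq_sym //.
  rewrite !betweenE ?Pneq // 1?eq_sym //.
  by rewrite !(flip a) // !(flip (m a)) // adja adjma.
(* A point under the new arc is under exactly one of the two glued arcs; the label of that arc, and
   so the minimum, is below [l c]. *)
have nestN c : m p != q -> c \in A' -> c != m p -> c != m q ->
    between (P (m p)) (P c) (P (m q)) -> minn (l p) (l q) < l c.
  move=> mpq cA' cx cy; have [cA cp cq adjc] := oth c cA'.
  have := nest p c pA cA; have := nest q c qA cA.
  rewrite gtn_min !betweenE ?Pneq ?mA // adjc.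
  move=> h1 h2 xy; apply/orP; move: h1 h2 xy.
  by case: (P c < P (m p)); case: (P c < P (m q));
    case: (P c < P q) => //= h1 h2 _;
    [right; apply: h1 | left; apply: h2 | left; apply: h2 | right; apply: h1].
have nestO a : m p != q -> a \in A' -> m a \in A' -> a != m p -> a != m q ->
    between (P a) (P (m p)) (P (m a)) -> l a < minn (l p) (l q).
  move=> mpq aA' maA' ax ay btw; have [aA ap aq _] := oth a aA'.
  have [_ pma qma _] := oth _ maA'; rewrite ltn_min !nest //.
    by rewrite (cross a q) ?(eq_sym q) // -crossO.
  by rewrite (cross a p) ?(eq_sym p).
have parityN : m p != q ->
    odd (minn (l p) (l q)) = odd (P (m p) + (P (m p) < P (m q))) /\
    odd (minn (l p) (l q)) = odd (P (m q) + (P (m q) < P (m p))).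
  move=> mpq; have [xA' yA' xy] := newA mpq.
  have [xA xp xq adjx] := oth _ xA'; have [yA yp yq adjy] := oth _ yA'.
  have par := planar_parity Apl; have qp : q != p by rewrite eq_sym.
  have := par p pA; have := par q qA; have := par _ xA; have := par _ yA.
  have := nest p (m q) pA yA; have := nest q (m p) qA xA.
  have := cross p q pA qA; have := cross q p qA pA.
  rewrite !lm // !mm // !betweenE ?Pneq // 1?eq_sym //
    ?[q == _]eq_sym ?[p == _]eq_sym //.
  rewrite !oddD !oddb oddpq adjx adjy.
  rewrite (flip (m p) q) // (flip (m p) (m q)) // (flip (m q) q) //.
  rewrite (flip (m p) p) // (flip (m q) p) // (flip p q) // adjx adjy.
  move=> /(_ qp yp) + /(_ qp xq) + /implyP + /implyP.
  rewrite /minn; case: (ltngtP (l p) (l q)) => _;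
    case: (P p < P q); case: (P (m p) < P q); case: (P (m q) < P q);
    case: (P (m p) < P (m q)) => //=;
    by case: (odd (l p)); case: (odd (l q)); case: (odd (P p));
       case: (odd (P (m p))); case: (odd (P (m q))).
split.
- by move=> u v /subA uA /subA vA; apply: (planar_inj Apl).
- by move=> u uA'; case: (contractP uA') => // _ /newA[].
- move=> u uA'; case: (contractP uA') => [-> /newA[_ _]|-> /newA[_ _]|_ _ _] //.
    by rewrite eq_sym.
  exact/mN/subA.
- move=> u uA'; case: (contractP uA') => [-> _|-> _|_ _ _].
  + by rewrite /contract_mate !mm // eqxx eq_sym (negPf npq).
  + by rewrite /contract_mate !mm // eqxx.
  + have [uA /negPf up /negPf uq _] := oth u uA'.
    by rewrite /contract_mate mm // up uq.
- move=> u uA'; case: (contractP uA') => [_ _|_ _|_ _ _].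
  + by rewrite /contract_label !mm // eqxx orbT.
  + by rewrite /contract_label !mm // eqxx.
  + have [uA /negPf up /negPf uq _] := oth u uA'.
    by rewrite /contract_label mm // up uq lm.
- move=> a c aA' cA'.
  case: (contractP aA') => [ea mpq|ea mpq|maA' ax ay];
    case: (contractP cA') => [ec pq'|ec pq'|mcA' cx cy];
      rewrite ?ea ?ec ?eqxx //.
  + by move=> _ _; apply: crossN.
  + by move=> _ _; rewrite ![between (P (m q)) _ _]betweenC; apply: crossN.
  + by move=> _ _; apply: crossO.
  + by move=> _ _; apply/esym/crossO.
  + by move=> ca cma; apply: cross => //; apply: subA.
- move=> a c aA' cA'; have [aA ap aq _] := oth a aA'.
  case: (contractP aA') => [ea mpq|ea mpq|maA' ax ay];
    case: (contractP cA') => [ec pq'|ec pq'|mcA' cx cy]; rewrite ?ea ?ec.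
  + by rewrite between_irrl.
  + by rewrite between_irrr.
  + exact: nestN.
  + by rewrite between_irrr.
  + by rewrite between_irrl.
  + rewrite betweenC; exact: nestN.
  + exact: nestO.
  + rewrite -crossO //; exact: nestO.
  + by apply: nest => //; apply: subA.
- move=> a aA'; case: (contractP aA') => [-> mpq|-> mpq|_ _ _].
  + by case: (parityN mpq).
  + by case: (parityN mpq).
  + exact/(planar_parity Apl)/subA.
Qed.

End Contraction.

(** * Connectivity under contraction *)

Lemma connect_ind (T : finType) (e : rel T) (Q : T -> Prop) u :
  Q u -> (forall x y, Q x -> e x y -> Q y) -> forall v, connect e u v -> Q v.
Proof.
move=> Qu Qe v /connectP[s + ->]; elim: s u Qu => //= x s IHs u Qu /andP[eux].
by apply: IHs; apply: Qe eux.
Qed.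

(** Relational form of the big minimum in [okada_mul], which can be transported between graphs on
    different node types. *)
Definition is_min (T : finType) (e : rel T) (lab : T -> nat) u n :=
  (exists2 v, connect e u v & lab v = n) /\
  (forall v, connect e u v -> n <= lab v).

Lemma is_min_uniq (T : finType) (e : rel T) lab u n n' :
  is_min e lab u n -> is_min e lab u n' -> n = n'.
Proof.
move=> [[v uv <-] le_n] [[v' uv' <-] le_n'].
by apply/eqP; rewrite eqn_leq le_n // le_n'.
Qed.

Section AddEdge.

Variables (T : finType) (e : rel T) (p q : T).
Hypothesis e_sym : connect_sym e.

Definition add_edge : rel T :=
  fun u v => [|| e u v, (u == p) && (v == q) | (u == q) && (v == p)].

(** A path crossing the new edge several times can be shortcut to one crossing, in one of the two
    directions. *)
Lemma connect_add_edge u v :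
  connect add_edge u v = [|| connect e u v, connect e u p && connect e q v
                           | connect e u q && connect e p v].
Proof.
have sub : subrel (connect e) (connect add_edge).
  by apply: connect_sub => x y exy; apply: connect1; rewrite /add_edge exy.
have pq : add_edge p q by rewrite /add_edge !eqxx orbT.
have qp : add_edge q p by rewrite /add_edge !eqxx !orbT.
apply/idP/idP => [|/or3P[/sub //|/andP[up qv]|/andP[uq pv]]]; last 2 first.
- exact: connect_trans (sub _ _ up) (connect_trans (connect1 pq) (sub _ _ qv)).
- exact: connect_trans (sub _ _ uq) (connect_trans (connect1 qp) (sub _ _ pv)).
move: v; apply: connect_ind => [|x y ux]; first by rewrite connect0.
case/or3P => [exy|/andP[/eqP xp /eqP->]|/andP[/eqP xq /eqP->]].
- have step w : connect e w x -> connect e w y.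
    by move/connect_trans; apply; apply: connect1.
  by case/or3P: ux => [/step->|/andP[-> /step->]|/andP[-> /step->]];
    rewrite ?orbT.
- move: ux; rewrite xp connect0 !andbT.
  by case/or3P => [->|/andP[-> _]|->]; rewrite ?connect0 ?orbT.
- move: ux; rewrite xq connect0 !andbT.
  by case/or3P => [->|->|/andP[-> _]]; rewrite ?connect0 ?orbT.
Qed.

Lemma add_edge_connect_sym : connect_sym add_edge.
Proof.
move=> u v; rewrite !connect_add_edge (e_sym u v); congr (_ || _).
by rewrite orbC (e_sym u p) (e_sym u q) (e_sym q v) (e_sym p v)
  ![_ && connect e _ u]andbC.
Qed.

End AddEdge.

(** Glued points leave [A] but stay in the graph, where they still count for the minimum. A closed
    loop becomes a component without points of [A], about which nothing is required. *)
Record linked (T : finType) (e : rel T) (lab : T -> nat) (A : {set T})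
    (m : T -> T) (l : T -> nat) : Prop := Linked {
  linked_sym : connect_sym e;
  linked_connect : {in A &, forall u v, connect e u v = (v == u) || (v == m u)};
  linked_min : {in A, forall u, is_min e lab u (l u)}
}.

Section LinkedContraction.

Variables (T : finType) (A : {set T}) (P : T -> nat).
Variables (m : T -> T) (l : T -> nat).
Hypothesis Apl : planar A P m l.
Variables (e : rel T) (lab : T -> nat) (p q : T).
Hypotheses (Alk : linked e lab A m l) (pA : p \in A) (qA : q \in A)
  (npq : p != q).

(** The new edge merges the components of [p] and [q], and the minimum over the union is the smaller
    of the two minima. *)
Lemma linked_contract : linked (add_edge e p q) lab (A :\ p :\ q)
  (contract_mate m p q) (contract_label m l p q).
Proof.
have [e_sym eA minA] := Alk.
have mm := planar_invol Apl; have mA := planar_mate Apl.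
have mN := planar_neq Apl; have lm := planar_label Apl.
split; first exact: add_edge_connect_sym.
- move=> u v uA' vA'.
  have [] : [/\ u \in A, v \in A & [/\ u != p, u != q, v != p & v != q]].
    by move: uA' vA'; rewrite !inE => /and3P[-> -> ->] /and3P[-> -> ->].
  move=> uA vA [up uq vp vq]; rewrite connect_add_edge // !eA //.
  rewrite (eq_sym p u) (eq_sym q u) (negPf up) (negPf uq) (negPf vp) (negPf vq)
    /=.
  rewrite (eq_sym p) (eq_sym q).
  case: (contractP Apl pA qA uA') => [-> mpq|-> mpq|muA' ump umq].
  + by rewrite !mm // eqxx (negPf vp) (negPf npq) /= !orbF.
  + by rewrite !mm // eqxx (negPf vq) (eq_sym q p) (negPf npq) /= !orbF.
  + by move: muA'; rewrite !inE => /and3P[/negPf-> /negPf-> _]; rewrite !orbF.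
- move=> u uA'; have [uA up uq] : [/\ u \in A, u != p & u != q].
    by move: uA'; rewrite !inE => /and3P[-> -> ->].
  have join v : (connect e p v || connect e q v) -> minn (l p) (l q) <= lab v.
    by case: (minA p pA) (minA q qA) => [_ lp] [_ lq] /orP[/lp|/lq]; lia.
  have [[v pv def_v] _] := minA p pA; have [[w qw def_w] _] := minA q qA.
  have attained x : (forall y, connect (add_edge e p q) x y =
        connect e p y || connect e q y) ->
      is_min (add_edge e p q) lab x (minn (l p) (l q)).
    move=> cx; split; last by move=> y; rewrite cx; apply: join.
    have [lpq|lqp] := leqP (l p) (l q).
      by exists v => //; rewrite cx pv.
    by exists w => //; rewrite cx qw orbT.
  have mateC x y : x \in A -> connect e (m x) y = connect e x y.
    by move=> xA; apply: (same_connect e_sym); rewrite eA ?mA // mm //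
      eqxx orbT.
  case: (contractP Apl pA qA uA') => [-> mpq|-> mpq|muA' ump umq].
  + apply: attained => y; rewrite connect_add_edge // !mateC // connect0.
    rewrite (eA p q) // (eq_sym q) (negPf npq) eq_sym (negPf mpq) /=.
    by rewrite orbF.
  + apply: attained => y; rewrite connect_add_edge // !mateC // connect0.
    rewrite (eA q p) // (negPf npq) -[p == m q]negbK.
    have -> : p != m q by apply: contra_neq mpq => ->; rewrite mm.
    by rewrite /= orbC.
  + have cx y : connect (add_edge e p q) u y = connect e u y.
      rewrite connect_add_edge // (eA u p) // (eA u q) //.
      rewrite (eq_sym p u) (eq_sym q u) (negPf up) (negPf uq) /=.
      rewrite (eq_sym p) (eq_sym q).
      by move: muA'; rewrite !inE => /and3P[/negPf-> /negPf-> _]; rewrite !orbF.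
    have [[x ux def_x] minu] := minA u uA.
    by split=> [|y]; [exists x; rewrite ?cx | rewrite cx; apply: minu].
Qed.

End LinkedContraction.

(** * Positions of the nodes on a line *)

Section Position.

Variable N : nat.
Implicit Types x y : node N.

Lemma posE x : pos x = if x.1 then N.*2 - x.2.+1 else x.2.
Proof. by []. Qed.

Lemma pos_lt x : pos x < N.*2.
Proof. by rewrite posE; case: x => [[] [i ltiN]] /=; lia. Qed.

Lemma overlinedE x : overlined x = (N <= pos x).
Proof. by rewrite posE /overlined; case: x => [[] [i ltiN]] /=; lia. Qed.

Lemma nabsE x : nabs x = if overlined x then N.*2 - pos x else (pos x).+1.
Proof. by rewrite posE /overlined /nabs; case: x => [[] [i ltiN]] //=; lia. Qed.

Lemma pos_inj : injective (@pos N).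
Proof.
move=> x y eq_pos; have eq1 : x.1 = y.1
  by rewrite -!/(overlined _) !overlinedE eq_pos.
move: eq_pos; rewrite !posE eq1; case: x y eq1 => [b [i lti]] [c [j ltj]] /=
  -> eq_ij.
by congr (_, _); apply: val_inj => /=; case: c eq_ij; lia.
Qed.

Lemma pos_neq x y : x != y -> pos x != pos y.
Proof. by apply: contra_neq => /pos_inj. Qed.

Lemma pos_bar x : pos (bar x) = N.*2 - (pos x).+1.
Proof. by rewrite !posE; case: x => [[] [i ltiN]] /=; lia. Qed.

Lemma barK : involutive (@bar N).
Proof. by case=> b i; rewrite /bar negbK. Qed.

Lemma card_pos_lt k : k <= N.*2 -> #|[set x : node N | pos x < k]| = k.
Proof.
elim: k => [|k IHk] ltk; first by apply: eq_card0 => x; rewrite inE.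
have [x posx] : exists x : node N, pos x = k.
  have [ltkN|leNk] := ltnP k N; first by exists (false, Ordinal ltkN).
  have lt' : N.*2 - k.+1 < N by lia.
  by exists (true, Ordinal lt'); rewrite posE /=; lia.
rewrite -[in RHS](IHk (ltnW ltk)) (cardsD1 x) inE posx ltnSn add1n; congr _.+1.
apply: eq_card => y; rewrite !inE; case: eqVneq => [->|/pos_neq]; first by lia.
by rewrite posx; lia.
Qed.

(** Positions fill the interval from 0 to 2N - 1, so counting the nodes under an arc gives the
    distance of its ends, whose parity is what matters. *)
Lemma card_between x y : pos x < pos y ->
  #|[set z : node N | between (pos x) (pos z) (pos y)]| = pos y - (pos x).+1.
Proof.
move=> ltxy; have := pos_lt x; have := pos_lt y => lty ltx.
rewrite -{2}(card_pos_lt (ltnW lty)) -(card_pos_lt ltx) -cardsDS.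
  by apply: eq_card => z; rewrite !inE /between; lia.
by apply/subsetP => z; rewrite !inE; lia.
Qed.

End Position.

(** * Okada diagrams as planar matchings *)

Section OkadaPlanar.

Variables (N : nat) (D : diag N).
Implicit Types a c x : node N.

Lemma okada_mateK : is_okada D -> involutive (mate D).
Proof. by move=> Dok x; case: (okada_matching Dok x). Qed.

Lemma okada_mate_neq : is_okada D -> forall x, mate D x != x.
Proof. by move=> Dok x; apply/eqP; case: (okada_matching Dok x). Qed.

Lemma okada_planar : is_okada D -> planar setT (@pos N) (mate D) (label D).
Proof.
move=> Dok; have mm := okada_mateK Dok; have mN := okada_mate_neq Dok.
have lm := okada_label_arc Dok; have cross := okada_non_crossing Dok.
have H a c : between (pos a) (pos c) (pos (mate D a)) ->
    between (pos a) (pos (mate D c)) (pos (mate D a)).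
  wlog ltama : a / pos a < pos (mate D a) => [IH btw|].
    case: (ltngtP (pos a) (pos (mate D a))) => [lt|lt|/pos_inj eqa].
    - exact: IH.
    - have := IH (mate D a); rewrite mm => /(_ lt).
      by rewrite !(betweenC (pos (mate D a)) _ (pos a)); apply.
    - by have := mN a; rewrite -eqa eqxx.
  rewrite /between => /orP[/andP[ac cma]|]; last by lia.
  have mca : mate D c != a by apply: contraTneq cma => <-; rewrite mm ltnn.
  have mcma : mate D c != mate D a.
    by rewrite (can_eq mm); apply: contraTneq ac => ->; rewrite ltnn.
  have := cross (mate D c) a; have := cross a c; rewrite mm.
  move: (pos_neq mca) (pos_neq mcma) => n1 n2 c1 c2.
  have {}c1 : ~~ (pos a < pos (mate D a) < pos (mate D c)).
    by apply/negP => /andP[_ lt]; apply: c1.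
  have {}c2 : ~~ (pos (mate D c) < pos a) by apply/negP => lt; apply: c2.
  lia.
have Heq a c : between (pos a) (pos c) (pos (mate D a)) =
    between (pos a) (pos (mate D c)) (pos (mate D a)).
  by apply/idP/idP => /H //; rewrite mm.
(* The nodes strictly under an arc are matched among themselves, so their number is even. *)
have oddm a : odd (pos (mate D a)) = ~~ odd (pos a).
  wlog ltama : a / pos a < pos (mate D a) => [IH|].
    case: (ltngtP (pos a) (pos (mate D a))) => [|lt|/pos_inj eqa];
      first exact: IH.
    - by have := IH (mate D a); rewrite mm => /(_ lt) ->; rewrite negbK.
    - by have := mN a; rewrite -eqa eqxx.
  have := card_involution_even
    (f := mate D) (A := [set z | between (pos a) (pos z) (pos (mate D a))]).
  rewrite card_between // oddB //= negb_add => /(_ _)/eqP; apply.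
  by move=> x; rewrite !inE => btw; rewrite -Heq.
split=> //.
- by move=> x y _ _; apply: pos_inj.
- move=> a c _ _ btw; have := H _ _ btw; move: btw.
  wlog ltama : a / pos a < pos (mate D a) => [IH btw btw'|].
    case: (ltngtP (pos a) (pos (mate D a))) => [lt|lt|/pos_inj eqa].
    - exact: IH.
    - by rewrite -lm; apply: IH; rewrite mm // betweenC.
    - by have := mN a; rewrite -eqa eqxx.
  rewrite /between => btw btw'.
  have [ltc|ltc] := ltnP (pos c) (pos (mate D c)).
    by apply: (okada_label_nested Dok); lia.
  have := pos_neq (mN c) => neqc; rewrite -(lm c).
  by apply: (okada_label_nested Dok); rewrite ?mm; lia.
(* Let [p] be the position of the left end. With two overlined ends the minimum is attained at the
   right end, whose absolute value is again odd exactly when [p.+1] is; for a propagating arc both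
   absolute values have this parity. *)
- move=> a _; have := okada_label_parity Dok a; rewrite !modn2 => par.
  have -> : odd (label D a) = odd (minn (nabs a) (nabs (mate D a))).
    by move: par; do 2!case: odd.
  have := oddm a; have := pos_lt a; have := pos_lt (mate D a).
  rewrite !nabsE !overlinedE; set p := pos a; set q := pos (mate D a).
  by clear; case: ltngtP; case: (leqP N p); case: (leqP N q); lia.
Qed.

(** Bounding a label by the absolute value of each node separately suffices, as both ends of an arc
    carry the same label. *)
Lemma planar_okada : planar setT (@pos N) (mate D) (label D) ->
  (forall x, 1 <= label D x <= nabs x) -> is_okada D.
Proof.
case=> _ _ mN mm lm cross nest par bound.
have {}mN x : mate D x != x by apply: mN.
have {}mm x : mate D (mate D x) = x by apply: mm.
have {}lm x : label D (mate D x) = label D x by apply: lm.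
split=> //.
- by move=> x; split=> //; apply/eqP.
- move=> a c [ac cma macm].
  have := cross a c (in_setT a) (in_setT c); rewrite /between.
  have -> : c != a by apply: contraTneq ac => ->; rewrite ltnn.
  have -> : c != mate D a by apply: contraTneq cma => ->; rewrite ltnn.
  by move=> /(_ isT isT); move: ac cma macm; lia.
- move=> x; have /andP[-> lex] := bound x.
  by rewrite leq_min lex -lm; have /andP[] := bound (mate D x).
- move=> x; rewrite !modn2; congr nat_of_bool.
  have := par x (in_setT x); have := par _ (in_setT (mate D x)); rewrite lm mm.
  have := pos_lt x; have := pos_lt (mate D x); have := pos_neq (mN x).
  rewrite !nabsE !overlinedE; set p := pos x; set q := pos (mate D x).
  move: (label D x) => n; clear.
  by case: (leqP N p); case: (leqP N q); case: (ltnP p q); case: (ltnP q p);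
    lia.
- by move=> a c ca ama mamc; apply: nest => //; rewrite /between; lia.
Qed.

Lemma okada_label_le : is_okada D -> forall x, 1 <= label D x <= nabs x.
Proof.
by move=> Dok x; have := okada_label_bound Dok x; rewrite leq_min; lia.
Qed.

End OkadaPlanar.

(** * Closure under product *)

Section Product.

Variables (N : nat) (C D : diag N).
Hypotheses (Cok : is_okada C) (Dok : is_okada D).

Definition stack_mate (u : stack_node N) : stack_node N :=
  match u with inl x => inl (mate C x) | inr x => inr (mate D x) end.

(* [C] is written to the left of [D]: bar 1 of [C] is then adjacent to 1 of [D],
   and once they are glued bar 2 becomes adjacent to 2, and so on. *)
Definition stack_pos (u : stack_node N) : nat :=
  match u with inl x => pos x | inr x => N.*2 + pos x end.

Definition partial_stack k : rel (stack_node N) :=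
  fun u v => stack_edge C D u v && match u, v with
    | inl x, inr y | inr y, inl x => (x.2 < k)%N
    | _, _ => true
    end.

Definition unglued k : {set stack_node N} :=
  [set u : stack_node N | match u with
    | inl x => ~~ x.1 || (k <= x.2) | inr y => y.1 || (k <= y.2) end].

Lemma stack_edge_sym : symmetric (stack_edge C D).
Proof.
move=> [x|x] [y|y] //=; apply/eqP/eqP => ->;
  by rewrite ?(okada_mateK Cok) ?(okada_mateK Dok).
Qed.

Lemma stack_planar : planar setT stack_pos stack_mate (stack_label C D).
Proof.
have [injC _ mNC mmC lmC crossC nestC parC] := okada_planar Cok.
have [injD _ mND mmD lmD crossD nestD parD] := okada_planar Dok.
have shift a b c : between (N.*2 + a) (N.*2 + b) (N.*2 + c) = between a b c.
  by rewrite /between !ltn_add2l.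
have sep a b c : a < N.*2 -> b < N.*2 ->
    (between a (N.*2 + c) b = false) *
    (between (N.*2 + a) b (N.*2 + c) = false).
  by split; rewrite /between; lia.
split=> //.
- move=> [x|x] [y|y] _ _ /=; rewrite ?inE.
  + by move/pos_inj->.
  + by have := pos_lt x; lia.
  + by have := pos_lt y; lia.
  + by move/addnI/pos_inj->.
- by move=> [x|x] _ /=; [apply: contraNneq (mNC x (in_setT x)) |
    apply: contraNneq (mND x (in_setT x))] => -[->].
- by move=> [x|x] _ /=; rewrite ?mmC ?mmD ?inE.
- by move=> [x|x] _ /=; rewrite ?lmC ?lmD ?inE.
- move=> [a|a] [c|c] _ _ /=.
  + by move=> ca cma; apply: crossC; rewrite ?inE.
  + by rewrite !sep ?pos_lt.
  + by rewrite !sep ?pos_lt.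
  + by move=> ca cma; rewrite !shift; apply: crossD; rewrite ?inE.
- move=> [a|a] [c|c] _ _ /=.
  + by apply: nestC; rewrite ?inE.
  + by rewrite !sep ?pos_lt.
  + by rewrite !sep ?pos_lt.
  + by rewrite !shift; apply: nestD; rewrite ?inE.
- move=> [a|a] _ /=; first by apply: parC.
  by rewrite ltn_add2l -addnA oddD odd_double; apply: parD.
Qed.

Lemma linked_glue k : k <= N -> exists m l,
  planar (unglued k) stack_pos m l /\
  linked (partial_stack k) (stack_label C D) (unglued k) m l.
Proof.
elim: k => [|k IHk] ltkN.
  exists stack_mate, (stack_label C D).
  have -> : unglued 0 = setT by apply/setP => -[x|x]; rewrite !inE orbT.
  split; first exact: stack_planar.
  have con u v : connect (partial_stack 0) u v =
    (v == u) || (v == stack_mate u).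
    apply/idP/idP => [|/orP[/eqP->//|/eqP->]]; last first.
      by apply: connect1; case: u => x; rewrite /partial_stack /= eqxx.
    move: v; apply: connect_ind => [|v w]; first by rewrite eqxx.
    case/orP => /eqP->; rewrite /partial_stack; case: u w => x [y|y] //=.
    + by rewrite andbT => /eqP->; rewrite eqxx orbT.
    + by rewrite ltn0 andbF.
    + by rewrite ltn0 andbF.
    + by rewrite andbT => /eqP->; rewrite eqxx orbT.
    + by rewrite (okada_mateK Cok) andbT => /eqP->; rewrite eqxx.
    + by rewrite ltn0 andbF.
    + by rewrite ltn0 andbF.
    + by rewrite (okada_mateK Dok) andbT => /eqP->; rewrite eqxx.
  split.
  - move=> u v; rewrite !con [u == v]eq_sym; congr (_ || _).
    by apply/eqP/eqP => ->; rewrite (planar_invol stack_planar) ?inE.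
  - by move=> u v _ _.
  - move=> u _; split=> [|v]; first by exists u.
    rewrite con => /orP[/eqP->|/eqP->] //.
    by rewrite (planar_label stack_planar) ?inE.
have [m [l [pl lk]]] := IHk (ltnW ltkN).
pose p : stack_node N := inl (true, Ordinal ltkN).
pose q : stack_node N := inr (false, Ordinal ltkN).
have pA : p \in unglued k by rewrite inE /=.
have qA : q \in unglued k by rewrite inE /=.
have in_p b (i : 'I_N) : (inl (b, i) == p) = b && (i == k :> nat).
  apply/eqP/andP => [[-> ->]|[bT /eqP ik]]; first by rewrite /= eqxx.
  by rewrite /p bT; congr (inl (_, _)); apply: val_inj.
have in_q b (i : 'I_N) : (inr (b, i) == q) = ~~ b && (i == k :> nat).
  apply/eqP/andP => [[-> ->]|[/negPf bF /eqP ik]]; first by rewrite /= eqxx.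
  by rewrite /q bF; congr (inr (_, _)); apply: val_inj.
have inr_p x : (inr x == p) = false by [].
have inl_q x : (inl x == q) = false by [].
have defA : unglued k.+1 = unglued k :\ p :\ q.
  apply/setP => -[[b i]|[b i]]; rewrite !inE ?in_p ?in_q /=; case: b => //=;
    lia.
have defe : partial_stack k.+1 =2 add_edge (partial_stack k) p q.
  rewrite /add_edge /partial_stack.
  move=> [[b i]|[b i]] [[c j]|[c j]] /=;
    rewrite ?inr_p ?inl_q ?in_p ?in_q ?andbF ?orbF //.
  - by rewrite /nabs ltnS leq_eqVlt /overlined /=; case: b c => [] [] //=; lia.
  - by rewrite /nabs ltnS leq_eqVlt /overlined /=; case: b c => [] [] //=; lia.
exists (contract_mate m p q), (contract_label m l p q); rewrite defA; split.
  (* The two positions are 2N - (k + 1) and 2N + k. They differ by 2k + 1, and the 2k points between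
     them are already glued. *)
  apply: planar_contract => //.
    by rewrite /= !posE /= oddD odd_double oddB; lia.
  by move=> [[b [i lti]]|[b [i lti]]];
    rewrite !inE ?inr_p ?inl_q ?in_p ?in_q /=;
    rewrite !posE /=; case: b => /=; lia.
have [esym econ emin] := linked_contract pl lk pA qA isT.
have defc := eq_connect defe.
split=> [u v|u v uA vA|u uA]; rewrite ?defc //; first exact: econ.
have [[v uv def_v] minu] := emin u uA.
by split=> [|w]; [exists v; rewrite ?defc | rewrite defc; apply: minu].
Qed.

Local Notation joined := (connect (stack_edge C D)).

(** The initial value of the big minimum is the label at [outer x], a member of the component, so it
    does no harm and the minimum is attained. *)
Lemma label_okada_mul x : is_min (stack_edge C D) (stack_label C D) (outer x)
  (label (okada_mul C D) x).
Proof.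
rewrite /label ffunE; split=> [|v xv]; last first.
  have := mem_index_enum v; elim: (index_enum _) => // w s IHs.
  rewrite inE big_cons => /predU1P[<-|/IHs le_v]; first by rewrite xv geq_minl.
  by case: ifP => _ //; rewrite geq_min le_v orbT.
elim/big_rec: _ => [|v n xv [w xw <-]]; first by exists (outer x).
by rewrite /minn; case: ifP => _; [exists v | exists w].
Qed.

Lemma okada_mul_spec : is_okada (okada_mul C D) /\
  forall x y, joined (outer x) (outer y) =
    (y == x) || (y == mate (okada_mul C D) x).
Proof.
have [m [l [pl [esym econ emin]]]] := linked_glue (leqnn N).
have defe : partial_stack N =2 stack_edge C D.
  by move=> [x|x] [y|y]; rewrite /partial_stack ?andbT // ltn_ord andbT.
have {}econ : {in unglued N &, forall u v, joined u v = (v == u) || (v == m u)}.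
  by move=> u v uA vA; rewrite -(eq_connect defe) econ.
have outA x : outer x \in unglued N.
  by rewrite /outer; case: x => [[] i]; rewrite inE.
have Aout u : u \in unglued N -> exists x, u = outer x.
  case: u => [[b i]|[b i]]; rewrite inE /= leqNgt ltn_ord orbF => bE.
    by exists (b, i); rewrite /outer /= (negPf bE).
  by exists (b, i); rewrite /outer /= bE.
have out_inj : injective (@outer N).
  by move=> [[] i] [[] j]; rewrite /outer //= => -[->].
have defm x : m (outer x) = outer (mate (okada_mul C D) x).
  have [y def_y] := Aout _ (planar_mate pl (outA x)).
  have yx : y != x.
    by apply: contraTneq (planar_neq pl (outA x)) => eyx;
      rewrite def_y eyx eqxx.
  rewrite /mate ffunE; case: pickP => [z /andP[zx]|/(_ y)]; last first.
    by rewrite yx econ ?outA // def_y eqxx orbT.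
  by rewrite econ ?outA // (inj_eq out_inj) (negPf zx) => /eqP->.
have defl x : l (outer x) = label (okada_mul C D) x.
  apply: is_min_uniq (label_okada_mul x).
  have [[v uv def_v] minu] := emin _ (outA x).
  by split=> [|w]; [exists v; rewrite -?(eq_connect defe)
                   | rewrite -(eq_connect defe); apply: minu].
split; last first.
  by move=> x y; rewrite econ ?outA // defm !(inj_eq out_inj).
(* [outer] preserves the order of positions, and it shifts the overlined nodes by the even number
   2N; all conditions can be read back on the original nodes. *)
have lt_out x y : (stack_pos (outer x) < stack_pos (outer y)) = (pos x < pos y).
  rewrite /outer; have := overlinedE x; have := overlinedE y.
  by have := pos_lt x; have := pos_lt y; case: ifP => /=; case: ifP => /=; lia.
have odd_out x : odd (stack_pos (outer x)) = odd (pos x).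
  by rewrite /outer; case: ifP => //=; rewrite oddD odd_double.
have btw_out x y z : between (stack_pos (outer x)) (stack_pos (outer y))
    (stack_pos (outer z)) = between (pos x) (pos y) (pos z).
  by rewrite /between !lt_out.
(* The bound: the minimum is one of the labels, hence positive, and is at most the label at the
   outer node itself, hence at most [nabs x]. *)
apply: planar_okada; last first.
  move=> x; have [[v _ <-] minx] := label_okada_mul x; apply/andP; split.
    by case: (v) => w /=;
      [have := okada_label_le Cok w | have := okada_label_le Dok w]; lia.
  move: minx => /(_ _ (connect0 _ _)) /leq_trans; apply; rewrite /outer.
  by case: ifP => /=; [have := okada_label_le Dok x
    | have := okada_label_le Cok x]; lia.
have [_ _ mN mm lm cross nest par] := pl; split.
- by move=> x y _ _; apply: pos_inj.
- by move=> x _; rewrite inE.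
- by move=> x _; have := mN _ (outA x); rewrite defm (inj_eq out_inj).
- by move=> x _; apply: out_inj; rewrite -!defm mm.
- by move=> x _; rewrite -!defl -defm lm.
- move=> a c _ _ ca cma; rewrite -!btw_out -!defm; apply: cross;
  rewrite ?outA //.
    by rewrite (inj_eq out_inj).
  by rewrite defm (inj_eq out_inj).
- move=> a c _ _; rewrite -!btw_out -!defm -!defl; apply: nest; exact: outA.
- by move=> x _; rewrite -defl par ?outA // !oddD defm lt_out odd_out.
Qed.

End Product.

(** * Associativity *)

Section Simulation.

(** [e] refines [e']: a node [u] is expanded to the points [t] with [Q u t], among them the
    representative [iota u]. [Q] is a relation and not a map back, since the two ends of a product
    arc are expanded to the same component. *)
Variables (U T : finType) (e' : rel U) (e : rel T) (lab' : U -> nat)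
  (lab : T -> nat).
Variables (iota : U -> T) (Q : U -> T -> Prop).
Hypotheses
  (fwd : forall u v, e' u v -> connect e (iota u) (iota v))
  (Qconnect : forall u t, Q u t -> connect e (iota u) t)
  (Qiota : forall u, Q u (iota u))
  (Qstep : forall u t t', Q u t -> e t t' ->
    exists2 u', connect e' u u' & Q u' t')
  (Qback : forall u v, Q u (iota v) -> connect e' u v)
  (Qle : forall u t, Q u t -> lab' u <= lab t)
  (Qattained : forall u, exists2 t, Q u t & lab t = lab' u).

Lemma simulation_fwd u v : connect e' u v -> connect e (iota u) (iota v).
Proof.
by move: v; apply: connect_ind => // v w uv /fwd; apply: connect_trans.
Qed.

Lemma simulation_back u t :
  connect e (iota u) t -> exists2 u', connect e' u u' & Q u' t.
Proof.
move: t; apply: connect_ind => [|t t' [v uv Qvt] ett']; first by exists u.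
have [w vw Qwt'] := Qstep Qvt ett'.
by exists w => //; apply: connect_trans vw.
Qed.

Lemma simulation_connect u v : connect e' u v = connect e (iota u) (iota v).
Proof.
apply/idP/idP => [|/simulation_back[w uw Qwv]]; first exact: simulation_fwd.
exact: connect_trans uw (Qback Qwv).
Qed.

Lemma simulation_min u n : is_min e' lab' u n -> is_min e lab (iota u) n.
Proof.
move=> [[v uv def_n] minu]; split=> [|t /simulation_back[w uw Qwt]].
  have [t Qvt def_t] := Qattained v; exists t; last by rewrite def_t.
  exact: connect_trans (simulation_fwd uv) (Qconnect Qvt).
exact: leq_trans (minu _ uw) (Qle Qwt).
Qed.

End Simulation.

(** A diagram is determined by its trace, so the two bracketings of a triple product agree once both
    are traces of [stack3]. *)
Definition trace (N : nat) (T : finType) (e : rel T) (lab : T -> nat)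
    (o : node N -> T) (D : diag N) : Prop :=
  (forall x y, connect e (o x) (o y) = (y == x) || (y == mate D x)) /\
  (forall x, is_min e lab (o x) (label D x)).

Lemma trace_uniq (N : nat) (T : finType) (e : rel T) lab o (D D' : diag N) :
  is_okada D -> is_okada D' ->
  trace e lab o D -> trace e lab o D' -> D = D'.
Proof.
move=> Dok D'ok [conD minD] [conD' minD'].
rewrite [D]surjective_pairing [D']surjective_pairing; congr (_, _);
  apply/ffunP => x.
  have := conD x (mate D' x);
    rewrite conD' eqxx orbT (negPf (okada_mate_neq D'ok x)).
  by move/esym/eqP.
exact: is_min_uniq (minD x) (minD' x).
Qed.

Section Associativity.

Variable N : nat.
Implicit Types B C D : diag N.

Lemma okada_mul_trace C D : is_okada C -> is_okada D ->
  trace (stack_edge C D) (stack_label C D) (@outer N) (okada_mul C D).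
Proof.
by move=> Cok Dok; split;
  [case: (okada_mul_spec Cok Dok) | apply: label_okada_mul].
Qed.

Lemma okada_mul_okada C D : is_okada C -> is_okada D ->
  is_okada (okada_mul C D).
Proof. by move=> Cok Dok; case: (okada_mul_spec Cok Dok). Qed.

Definition stack3_node : finType := (stack_node N + node N)%type.

Definition glued (x y : node N) :=
  [&& overlined x, ~~ overlined y & nabs x == nabs y].

Definition stack3 B C D : rel stack3_node :=
  fun u v => match u with
  | inl u => match v with
      | inl v => stack_edge B C u v
      | inr y => if u is inr x then glued x y else false
      end
  | inr x => match v with
      | inl v => if v is inr y then glued y x else false
      | inr y => y == mate D x
      end
  end.

Definition stack3_label B C D (u : stack3_node) : nat :=
  match u with inl u => stack_label B C u | inr x => label D x end.

Definition outer3 (x : node N) : stack3_node :=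
  if overlined x then inr x else inl (inl x).

Lemma trace_okada_mulA_l B C D : is_okada B -> is_okada C -> is_okada D ->
  trace (stack3 B C D) (stack3_label B C D) outer3
    (okada_mul (okada_mul B C) D).
Proof.
move=> Bok Cok Dok; have BCok := okada_mul_okada Bok Cok.
have [conBC minBC] := okada_mul_trace Bok Cok.
have [con3 min3] := okada_mul_trace BCok Dok.
pose iota (u : stack_node N) : stack3_node :=
  match u with inl x => inl (outer x) | inr y => inr y end.
(* Every point of a component of the upper two storeys is related to both of its outer ends; points
   on closed loops are related to no node. *)
pose Q (u : stack_node N) (t : stack3_node) : Prop := match u, t with
  | inl x, inl t => connect (stack_edge B C) (outer x) t
  | inr x, inr t => t = x | _, _ => False end.
have inlC u v : connect (stack_edge B C) u v ->
  connect (stack3 B C D) (inl u) (inl v).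
  move: v; apply: connect_ind => [|v w uv vw]; first exact: connect0.
  by apply: connect_trans uv _; apply: connect1.
have con_mate (x y : node N) : connect (stack_edge B C) (outer x) (outer y) ->
    connect (stack_edge (okada_mul B C) D) (inl x) (inl y).
  by rewrite conBC => /orP[/eqP->//|xy]; apply: connect1.
have outC x : iota (outer x) = outer3 x.
  by rewrite /outer3 /outer; case: ifP => xb //=; rewrite /outer xb.
have fwd u v : stack_edge (okada_mul B C) D u v ->
    connect (stack3 B C D) (iota u) (iota v).
  case: u v => [x|x] [y|y] /=; last by move=> xy; apply: connect1.
  - by move=> xy; apply: inlC; rewrite conBC xy orbT.
  - by move=> xy; apply: connect1; rewrite /= /outer; case/andP: (xy) => ->.
  - by move=> xy; apply: connect1; rewrite /= /outer; case/andP: (xy) => ->.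
have Qcon u t : Q u t -> connect (stack3 B C D) (iota u) t.
  by case: u t => x [t|t] //=; [apply: inlC | move->].
have Qiota u : Q u (iota u) by case: u => x /=.
have Qstep u t t' : Q u t -> stack3 B C D t t' ->
    exists2 u', connect (stack_edge (okada_mul B C) D) u u' & Q u' t'.
  case: u t t' => x [t|t] [t'|t'] //=.
  - by move=> xt tt'; exists (inl x) => //=;
    apply: connect_trans xt (connect1 tt').
  - case: t => // t xt tt'; exists (inr t') => //.
    have out_t : inr t = outer t by rewrite /outer; case/andP: tt' => ->.
    rewrite out_t in xt; apply: connect_trans (con_mate _ _ xt) _.
    exact: connect1.
  - move=> ->; case: t' => // t' t't; exists (inl t').
      exact: connect1.
    by rewrite /= /outer; case/andP: t't => ->.
  - by move=> -> xt; exists (inr t') => //; apply: connect1.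
have Qback u v : Q u (iota v) -> connect (stack_edge (okada_mul B C) D) u v.
  by case: u v => x [y|y] //=; [apply: con_mate | move->].
have Qle u t : Q u t -> stack_label (okada_mul B C) D u <= stack3_label B C D t.
  by case: u t => x [t|t] //=; [case: (minBC x) => _; apply | move->].
have Qatt u : exists2 t, Q u t
  & stack3_label B C D t = stack_label (okada_mul B C) D u.
  case: u => x /=; last by exists (inr x).
  by have [[t xt tx] _] := minBC x; exists (inl t).
split=> [x y|x]; rewrite -!outC.
  by rewrite -(simulation_connect fwd Qiota Qstep Qback).
exact: simulation_min fwd Qcon Qiota Qstep Qle Qatt _ _ (min3 x).
Qed.

Lemma trace_okada_mulA_r B C D : is_okada B -> is_okada C -> is_okada D ->
  trace (stack3 B C D) (stack3_label B C D) outer3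
    (okada_mul B (okada_mul C D)).
Proof.
move=> Bok Cok Dok; have CDok := okada_mul_okada Cok Dok.
have [conCD minCD] := okada_mul_trace Cok Dok.
have [con3 min3] := okada_mul_trace Bok CDok.
(* [stack3_node] is associated to the left, so the two lower storeys do not form a summand and have
   to be embedded by hand. *)
pose shift (u : stack_node N) : stack3_node :=
  match u with inl x => inl (inr x) | inr y => inr y end.
pose iota (u : stack_node N) : stack3_node :=
  match u with inl x => inl (inl x) | inr y => shift (outer y) end.
pose Q (u : stack_node N) (t : stack3_node) : Prop := match u, t with
  | inl x, inl (inl t) => t = x
  | inr x, inl (inr t) => connect (stack_edge C D) (outer x) (inl t)
  | inr x, inr t => connect (stack_edge C D) (outer x) (inr t)
  | _, _ => False end.
have Qshift x u : Q (inr x) (shift u) = connect (stack_edge C D) (outer x) u.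
  by case: u.
have shiftC u v : connect (stack_edge C D) u v ->
    connect (stack3 B C D) (shift u) (shift v).
  move: v; apply: connect_ind => [|v w uv vw]; first exact: connect0.
  apply: connect_trans uv _; apply: connect1.
  by case: v w vw => [v|v] [w|w].
have con_mate (x y : node N) : connect (stack_edge C D) (outer x) (outer y) ->
    connect (stack_edge B (okada_mul C D)) (inr x) (inr y).
  by rewrite conCD => /orP[/eqP->//|xy]; apply: connect1.
have outC x : iota (outer x) = outer3 x.
  by rewrite /outer3 /outer; case: ifP => xb //=; rewrite /outer xb.
have fwd u v : stack_edge B (okada_mul C D) u v ->
    connect (stack3 B C D) (iota u) (iota v).
  case: u v => [x|x] [y|y] /=; first by move=> xy; apply: connect1.
  - by case/and3P=> xb yb xy; apply: connect1;
    rewrite /outer (negPf yb) /= xb yb.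
  - by case/and3P=> xb yb xy; apply: connect1;
    rewrite /outer (negPf yb) /= xb yb.
  - by move=> xy; apply: shiftC; rewrite conCD xy orbT.
have Qcon u t : Q u t -> connect (stack3 B C D) (iota u) t.
  by case: u t => x [[t|t]|t] //=; [move-> | move/shiftC..].
have Qiota u : Q u (iota u) by case: u => x //; rewrite /iota Qshift.
have Qstep u t t' : Q u t -> stack3 B C D t t' ->
    exists2 u', connect (stack_edge B (okada_mul C D)) u u' & Q u' t'.
  have inner x v w : connect (stack_edge C D) (outer x) v ->
    stack_edge C D v w ->
      exists2 u', connect (stack_edge B (okada_mul C D)) (inr x) u'
        & Q u' (shift w).
    by move=> xv vw; exists (inr x) => //; rewrite Qshift;
      apply: connect_trans xv (connect1 vw).
  case: u t t' => x [[t|t]|t] [[t'|t']|t'] //=.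
  - by move=> -> xt; exists (inl t') => //; apply: connect1.
  - move=> -> xt; exists (inr t'); first exact: connect1.
    by rewrite /= /outer; case/and3P: xt => _ /negPf->.
  - move=> xt t't; exists (inl t') => //.
    have out_t : inl t = outer t
      by rewrite /outer; case/and3P: t't => _ /negPf->.
    rewrite out_t in xt; apply: connect_trans (con_mate _ _ xt) _.
    exact: connect1.
  - by move=> xt tt'; apply: (inner x (inl t) (inl t')).
  - by move=> xt tt'; apply: (inner x (inl t) (inr t')).
  - by move=> xt tt'; apply: (inner x (inr t) (inl t')).
  - by move=> xt tt'; apply: (inner x (inr t) (inr t')).
have Qback u v : Q u (iota v) -> connect (stack_edge B (okada_mul C D)) u v.
  case: u v => x [y|y] //; [by move=> /= -> | by rewrite /=; case: (outer y) |].
  by rewrite [iota _]/= Qshift; apply: con_mate.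
have labE u : stack3_label B C D (shift u) = stack_label C D u by case: u.
have Qle u t : Q u t -> stack_label B (okada_mul C D) u <= stack3_label B C D t.
  case: u t => x [[t|t]|t] //=; first by move->.
    by case: (minCD x) => _ /(_ (inl t)).
  by case: (minCD x) => _ /(_ (inr t)).
have Qatt u : exists2 t, Q u t
  & stack3_label B C D t = stack_label B (okada_mul C D) u.
  case: u => x; first by exists (inl (inl x)).
  by have [[t xt tx] _] := minCD x; exists (shift t); rewrite ?Qshift ?labE.
split=> [x y|x]; rewrite -!outC.
  by rewrite -(simulation_connect fwd Qiota Qstep Qback).
exact: simulation_min fwd Qcon Qiota Qstep Qle Qatt _ _ (min3 x).
Qed.

Lemma okada_mulA B C D : is_okada B -> is_okada C -> is_okada D ->
  okada_mul B (okada_mul C D) = okada_mul (okada_mul B C) D.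
Proof.
move=> Bok Cok Dok; apply: trace_uniq (trace_okada_mulA_r _ _ _)
  (trace_okada_mulA_l _ _ _) => //; by do ?apply: okada_mul_okada.
Qed.

End Associativity.

(** * Propagating arcs and the mirror image *)

Section Sides.

Variable N : nat.
Implicit Types x y z : node N.

Lemma between_same_side x y z : overlined y = overlined x ->
  overlined z != overlined x -> between (pos x) (pos z) (pos y) = false.
Proof.
rewrite !overlinedE /between; case: (leqP N (pos x)); case: (leqP N (pos y));
  by case: (leqP N (pos z)) => //; lia.
Qed.

(** The right-hand side does not mention [y]: replacing the far end of a propagating arc does not
    change which nodes it covers on the near side. *)
Lemma between_opposite_sides x y z : overlined y != overlined x ->
  overlined z = overlined x ->
    between (pos x) (pos z) (pos y) = (nabs x < nabs z).
Proof.
rewrite !nabsE !overlinedE /between; have := pos_lt x; have := pos_lt z.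
by case: (leqP N (pos x)); case: (leqP N (pos y)); case: (leqP N (pos z)) => //;
  lia.
Qed.

Lemma lt_pos_opposite x y : overlined y != overlined x ->
  (pos x < pos y) = ~~ overlined x.
Proof.
by rewrite !overlinedE; case: (leqP N (pos x)); case: (leqP N (pos y)) => //;
  lia.
Qed.

Lemma nabs_inj x y : overlined x = overlined y -> nabs x = nabs y -> x = y.
Proof.
case: x y => b i [c j] /=; rewrite /overlined /nabs /= => -> [] /val_inj ->.
by [].
Qed.

End Sides.

Section Propagating.

Variables (N : nat) (D : diag N).
Hypothesis Dok : is_okada D.
Implicit Types x y : node N.

Lemma propagating_mate x : propagating D (mate D x) = propagating D x.
Proof. by rewrite /propagating (okada_mateK Dok) eq_sym. Qed.

(** A propagating arc covers all nodes of larger absolute value on either side, so on one side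
    labels and absolute values grow together. *)
Lemma propagating_label_lt x y : propagating D x -> propagating D y ->
  overlined x = overlined y -> (label D x < label D y) = (nabs x < nabs y).
Proof.
have lt u v : propagating D u -> overlined v = overlined u ->
    nabs u < nabs v -> label D u < label D v.
  move=> pu vu; rewrite -(@between_opposite_sides _ u (mate D u) v) //.
    by apply: (planar_nest (okada_planar Dok)); rewrite inE.
  by rewrite eq_sym.
move=> px py xy; case: (ltngtP (nabs x) (nabs y)) => [|/lt|/(nabs_inj xy)->].
- exact: lt.
- by move=> /(_ py xy); case: ltngtP.
- by rewrite ltnn.
Qed.

Lemma propagating_label_inj x y : propagating D x -> propagating D y ->
  overlined x = overlined y -> label D x = label D y -> x = y.
Proof.
move=> px py xy eq_l; apply: nabs_inj => //.
have := propagating_label_lt px py xy;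
  have := propagating_label_lt py px (esym xy).
by rewrite eq_l ltnn; lia.
Qed.

Lemma label_leN x : label D x <= N.
Proof.
have /andP[_ /leq_trans] := okada_label_le Dok x; apply; exact: ltn_ord.
Qed.

Lemma mem_PLab (l : 'I_N.+1) :
  reflect (exists2 x, propagating D x & label D x = l) (l \in PLab D).
Proof.
rewrite inE; apply: (iffP existsP) => [[x /andP[px /eqP xl]]|[x px xl]];
  exists x => //.
by rewrite px xl eqxx.
Qed.

Lemma PLab_side (l : 'I_N.+1) b : l \in PLab D ->
  exists x, [/\ overlined x = b, propagating D x & label D x = l].
Proof.
case/mem_PLab => x px xl; have [xb|xb] := eqVneq (overlined x) b;
  first by exists x.
exists (mate D x); rewrite propagating_mate (okada_label_arc Dok); split=> //.
move: px xb; rewrite /propagating.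
by case: (overlined x); case: (overlined (mate D x)); case: b.
Qed.

End Propagating.

Section Mirror.

Variables (N : nat) (D : diag N).
Implicit Types x y : node N.

Lemma mate_mirror x : mate (mirror D) x = bar (mate D (bar x)).
Proof. by rewrite /mate ffunE. Qed.

Lemma label_mirror x : label (mirror D) x = label D (bar x).
Proof. by rewrite /label ffunE. Qed.

Lemma propagating_mirror x : propagating (mirror D) x = propagating D (bar x).
Proof. by rewrite /propagating mate_mirror; case: x => [] [] i;
  rewrite /= /overlined /=; case: (_.1). Qed.

Lemma okada_mirror : is_okada D -> is_okada (mirror D).
Proof.
move=> Dok; have [_ _ mN mm lm cross nest par] := okada_planar Dok.
have lt_bar x y : (pos (bar x) < pos (bar y)) = (pos y < pos x).
  by rewrite !pos_bar; have := pos_lt x; have := pos_lt y; lia.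
have btw_bar (x y z : node N) : between (pos x) (pos y) (pos (bar z)) =
    between (pos (bar x)) (pos (bar y)) (pos z).
  rewrite -[in RHS](barK z) /between !lt_bar [RHS]orbC.
  by congr (_ || _); rewrite andbC.
apply: planar_okada => [|x]; last first.
  by rewrite label_mirror; apply: (okada_label_le Dok).
split.
- by move=> x y _ _; apply: pos_inj.
- by move=> x _; rewrite inE.
- move=> x _; rewrite mate_mirror (inv_eq (@barK N)).
  by apply: mN; rewrite inE.
- by move=> x _; rewrite !mate_mirror barK mm ?inE // barK.
- by move=> x _; rewrite mate_mirror !label_mirror barK lm ?inE.
- move=> a c _ _ ca cma; rewrite !mate_mirror in cma *.
  rewrite !btw_bar barK; apply: cross;
    rewrite ?inE ?(inj_eq (can_inj (@barK N))) //.
  by rewrite (inv_eq (@barK N)).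
- move=> a c _ _; rewrite mate_mirror !label_mirror btw_bar; apply: nest;
  exact: in_setT.
(* Reversing the line changes the parity of each position and exchanges left and right ends; the two
   changes cancel. *)
- move=> x _; rewrite label_mirror mate_mirror par ?inE //.
  have := pos_neq (mN (bar x) (in_setT _)); rewrite !pos_bar.
  have := pos_lt x; have := pos_lt (mate D (bar x)).
  set p := pos x; set q := pos (mate D (bar x)) => ltq ltp neq.
  by rewrite !oddD !oddb oddB // odd_double; lia.
Qed.

End Mirror.

Lemma mirrorK N : involutive (@mirror N).
Proof.
move=> D; rewrite [RHS]surjective_pairing; congr (_, _); apply/ffunP => x.
  by rewrite ffunE mate_mirror !barK.
by rewrite ffunE label_mirror barK.
Qed.

Lemma PLab_mirror N (D : diag N) : PLab (mirror D) = PLab D.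
Proof.
apply/setP => l; apply/mem_PLab/mem_PLab => -[x px xl]; exists (bar x).
- by rewrite -propagating_mirror.
- by rewrite -label_mirror.
- by rewrite propagating_mirror barK.
- by rewrite label_mirror barK.
Qed.

(** * Recombining half diagrams *)

(* The upper half of [h false] over the lower half of [h true]; the cut
   propagating arcs are sewn back according to their labels. *)
Definition join N (h : bool -> diag N) : diag N :=
  ([ffun x => let D := h (overlined x) in
      if propagating D x then
        odflt x [pick z | [&& overlined z == ~~ overlined x,
          propagating (h (overlined z)) z
          & label (h (overlined z)) z == label D x]]
      else mate D x],
   [ffun x => label (h (overlined x)) x]).

Section Join.

Variables (N : nat) (h : bool -> diag N).
Hypothesis hok : forall b, is_okada (h b).
Hypothesis hPLab : PLab (h false) = PLab (h true).
Implicit Types x y z : node N.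

Local Notation side x := (h (overlined x)).

Lemma label_join x : label (join h) x = label (side x) x.
Proof. by rewrite /label ffunE. Qed.

Variant join_spec x : node N -> Prop :=
| JoinProp z of propagating (side x) x & overlined z = ~~ overlined x
    & propagating (side z) z & label (side z) z = label (side x) x :
      join_spec x z
| JoinStay of ~~ propagating (side x) x
    & overlined (mate (side x) x) = overlined x : join_spec x (mate (side x) x).

(** Equality of the propagating label sets makes the search in [join] succeed, so its default value
    is never returned. *)
Lemma joinP x : join_spec x (mate (join h) x).
Proof.
rewrite {1}/mate ffunE /=; case: ifPn => px; last first.
  by constructor => //; move: px; rewrite negbK => /eqP.
case: pickP => [z /and3P[/eqP xz pz /eqP zl]|none]; first by constructor.
pose l : 'I_N.+1 := Ordinal (label_leN (hok (overlined x)) x :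
  label (side x) x < N.+1).
have lx : l \in PLab (side x) by apply/mem_PLab; exists x.
have : l \in PLab (h (~~ overlined x)).
  by case: (overlined x) lx; rewrite ?hPLab // -hPLab.
case/(PLab_side (hok _) (~~ overlined x)) => z [zb pz zl].
by have := none z; rewrite zb eqxx pz zl eqxx.
Qed.

Lemma join_uniq x z : propagating (side x) x -> overlined z = ~~ overlined x ->
  propagating (side z) z -> label (side z) z = label (side x) x ->
  mate (join h) x = z.
Proof.
move=> px xz pz zl; case: (joinP x) => [y _ yx py yl|]; last by rewrite px.
have yz : overlined y = overlined z by rewrite yx.
apply: (propagating_label_inj (hok (overlined z))) => //; first by rewrite -yz.
by rewrite zl -yl yz.
Qed.

Lemma join_stay x : ~~ propagating (side x) x ->
  mate (join h) x = mate (side x) x.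
Proof. by move/negPf=> px; rewrite {1}/mate ffunE /= px. Qed.

Lemma propagating_join x : propagating (join h) x = propagating (side x) x.
Proof.
rewrite {1}/propagating; case: (joinP x) => [z -> ->|/negPf-> ->];
  last by rewrite eqxx.
by case: overlined.
Qed.

Lemma join_okada : is_okada (join h).
Proof.
have pmate b x := propagating_mate (hok b) x.
have cross b x y := planar_cross (okada_planar (hok b)) (in_setT x) (in_setT y).
have nest b x y := planar_nest (okada_planar (hok b)) (in_setT x) (in_setT y).
have par b x := planar_parity (okada_planar (hok b)) (in_setT x).
have lt_lab x y : propagating (side x) x -> propagating (side y) y ->
    overlined x = overlined y ->
    (label (side x) x < label (side y) y) = (nabs x < nabs y).
  move=> px py xy; rewrite -xy; apply: propagating_label_lt => //.
  by rewrite xy.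
have far x z : overlined z = ~~ overlined x -> (overlined z != overlined x).
  by move=> ->; case: overlined.
apply: planar_okada => [|x]; last first.
  by rewrite label_join; apply: okada_label_le.
split.
- by move=> x y _ _; apply: pos_inj.
- by move=> x _; rewrite inE.
- move=> x _; case: (joinP x) => [z _ /far + _ _|_ _].
    by apply: contraNneq => ->.
  exact: okada_mate_neq.
- move=> x _; case: (joinP x) => [z px zx pz zl|px xb].
    by apply: join_uniq => //; rewrite zx negbK.
  by rewrite join_stay xb ?okada_mateK // pmate.
- move=> x _; rewrite !label_join; case: (joinP x) => [z _ _ _ -> //|_ xb].
  by rewrite xb; apply: okada_label_arc.
- move=> a c _ _; case: (joinP a) => [z pa za pz zl|pa ab].
    (* Two sewn arcs: on both sides absolute values are ordered as the labels, so the arcs are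
       nested and do not cross. *)
    have cut x y u v : propagating (side x) x -> propagating (side u) u ->
       propagating (side v) v -> propagating (side y) y ->
       label (side y) y = label (side x) x ->
         label (side v) v = label (side u) u ->
       overlined y = ~~ overlined x -> overlined u = overlined x ->
       overlined v = overlined y ->
       between (pos x) (pos u) (pos y) = between (pos x) (pos v) (pos y).
      move=> px pu pv py xy uv yx ux vy.
      rewrite between_opposite_sides ?far // [RHS]betweenC.
      rewrite (@between_opposite_sides _ y) ?yx ?vy //; last by case: overlined.
      by rewrite -(lt_lab x u) // -(lt_lab y v) // xy uv.
    case: (joinP c) => [w pc wc pw wl|pc cb] ca cz.
      have [cea|cea] := eqVneq (overlined c) (overlined a).
        by apply: cut => //; rewrite wc za cea.
      have cez : overlined c = overlined z.
        by rewrite za; move: cea; do 2!case: overlined.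
      rewrite !(betweenC (pos a)); apply: cut => //.
      - by rewrite za negbK.
      - by rewrite wc cez za negbK.
    (* A sewn arc and an arc staying on one side: on that side the sewn arc covers the same nodes as
       the old propagating arc at [x], which does not cross the staying arc. *)
    have stay x y : propagating (side x) x -> overlined y = ~~ overlined x ->
        overlined c = overlined x -> c != x ->
        between (pos x) (pos c) (pos y) =
        between (pos x) (pos (mate (side c) c)) (pos y).
      move=> px yx cx ncx; rewrite !between_opposite_sides ?far ?cb //.
      have xm : overlined (mate (side x) x) != overlined x by rewrite eq_sym.
      rewrite -!(@between_opposite_sides _ x (mate (side x) x)) ?cb //.
      rewrite cx in pc *; apply: cross => //.
      by apply: contraNneq pc => ->; rewrite pmate.
    have [cea|cea] := eqVneq (overlined c) (overlined a); first exact: stay.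
    rewrite !(betweenC (pos a)); apply: stay => //; first by rewrite za negbK.
    by rewrite za; move: cea; case: (overlined c); case: (overlined a).
  (* An arc staying on one side covers no propagating node, since it would have to cover the mate on
     the other side too. *)
  have outside y : propagating (side y) y -> overlined y = overlined a ->
      between (pos a) (pos y) (pos (mate (side a) a)) = false.
    move=> py ya; rewrite ya in py; rewrite cross.
    - by apply: between_same_side => //; rewrite -[X in _ != X]ya eq_sym.
    - by apply: contraTneq py => ->.
    - by apply: contraTneq py => ->; rewrite pmate.
  case: (joinP c) => [w pc wc pw _|pc cb] ca cm.
    have [cea|cea] := eqVneq (overlined c) (overlined a).
      by rewrite outside // between_same_side // wc cea; case: overlined.
    rewrite between_same_side // outside // wc.
    by move: cea; case: (overlined c); case: (overlined a).
  have [cea|cea] := eqVneq (overlined c) (overlined a).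
    by rewrite cea in cb *; apply: cross.
  by rewrite !between_same_side ?cb.
- move=> a c _ _; rewrite !label_join; case: (joinP a) => [z pa za pz zl|pa ab].
    have near x y : propagating (side x) x -> overlined y = ~~ overlined x ->
        overlined c = overlined x -> between (pos x) (pos c) (pos y) ->
        label (side x) x < label (side c) c.
      move=> px yx cx; rewrite between_opposite_sides ?far // cx.
      rewrite -(@between_opposite_sides _ x (mate (side x) x)) //;
        first exact: nest.
      by rewrite eq_sym.
    have [cea|cea] := eqVneq (overlined c) (overlined a); first exact: near.
    rewrite betweenC -zl; apply: near => //; first by rewrite za negbK.
    by rewrite za; move: cea; case: (overlined c); case: (overlined a).
  have [cea|cea] := eqVneq (overlined c) (overlined a).
    by rewrite cea; apply: nest.
  by rewrite between_same_side.
(* The left end of a propagating arc is the one that is not overlined, before and after sewing. *)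
- move=> x _; rewrite label_join par.
  case: (joinP x) => [z px xz _ _|] //.
  have xm : overlined (mate (side x) x) != overlined x by rewrite eq_sym.
  by rewrite (lt_pos_opposite xm) (lt_pos_opposite (far _ _ xz)).
Qed.

End Join.

Definition join2 N (e f : diag N) : diag N :=
  join (fun b => if b then f else e).

Section Join2.

Variable N : nat.
Implicit Types (e f g : diag N) (x : node N).

Lemma join2_okada e f : is_okada e -> is_okada f -> PLab e = PLab f ->
  is_okada (join2 e f).
Proof. by move=> eok fok ef; apply: join_okada => // -[]. Qed.

Lemma eq_diag e f : mate e =1 mate f -> label e =1 label f -> e = f.
Proof.
rewrite [e]surjective_pairing [f]surjective_pairing => mef lef.
by congr (_, _); apply/ffunP.
Qed.

Lemma join2_id e : is_okada e -> join2 e e = e.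
Proof.
move=> eok; have sideE b : (if b then e else e) = e by case: b.
apply: eq_diag => x; last by rewrite label_join sideE.
have [px|px] := boolP (propagating e x); last by rewrite join_stay sideE.
apply: join_uniq; rewrite ?sideE ?propagating_mate ?(okada_label_arc eok) //.
- by case.
- by move: px; rewrite /propagating; do 2!case: (overlined _).
Qed.

Lemma mirror_join2 e f : is_okada e -> is_okada f -> PLab e = PLab f ->
  mirror (join2 e f) = join2 (mirror f) (mirror e).
Proof.
move=> eok fok ef.
have barO x : overlined (bar x) = ~~ overlined x by [].
have sideE x : (if overlined x then mirror e else mirror f) =
    mirror (if overlined (bar x) then f else e).
  by rewrite barO; case: overlined.
apply: eq_diag => x; last by rewrite label_mirror !label_join sideE
  label_mirror.
rewrite mate_mirror; have hok b : is_okada (if b then f else e) by case: b.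
case: (joinP hok ef (bar x)) => [z px xz pz zl|px _].
  apply/esym/join_uniq; first by case; apply: okada_mirror.
  - by rewrite !PLab_mirror ef.
  - by rewrite sideE propagating_mirror.
  - by rewrite !barO xz barO negbK.
  - by rewrite sideE propagating_mirror barK.
  - by rewrite !sideE !label_mirror barK.
by rewrite join_stay sideE ?propagating_mirror // mate_mirror.
Qed.

(** The condition on [x] spares tracing propagating arcs upwards; that direction follows as both
    mates are involutions. *)
Lemma okada_mul_uniq (C D E : diag N) : is_okada C -> is_okada D ->
  is_okada E ->
  (forall x, ~~ overlined x || overlined (mate E x) ->
     connect (stack_edge C D) (outer x) (outer (mate E x))) ->
  (forall x, label (okada_mul C D) x = label E x) -> okada_mul C D = E.
Proof.
move=> Cok Dok Eok conE labE; apply: eq_diag => // x.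
have [con _] := okada_mul_trace Cok Dok; have /negPf xm := okada_mate_neq Eok x.
have [xE|] := boolP (~~ overlined x || overlined (mate E x)).
  by have := conE x xE; rewrite con xm /= => /eqP.
rewrite negb_or negbK => /andP[xb xmb].
have := conE (mate E x); rewrite xmb (okada_mateK Eok) => /(_ isT).
rewrite con eq_sym xm /= => /eqP def_x.
by rewrite {1}def_x (okada_mateK (okada_mul_okada Cok Dok)).
Qed.

(** The two halves that meet in the middle are mirror images: their non-propagating arcs close up
    into loops, and cut ends with the same label meet. *)
Lemma join2_mul e f g : is_okada e -> is_okada f -> is_okada g ->
  PLab e = PLab f -> PLab f = PLab g ->
  okada_mul (join2 e f) (join2 (mirror f) g) = join2 e g.
Proof.
move=> eok fok gok ef fg.
have mfok : is_okada (mirror f) by apply: okada_mirror.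
have mfg : PLab (mirror f) = PLab g by rewrite PLab_mirror.
have Cok := join2_okada eok fok ef; have Dok := join2_okada mfok gok mfg.
have Eok := join2_okada eok gok (etrans ef fg).
set C := join2 e f in Cok *; set D := join2 (mirror f) g in Dok *.
(* Labels are constant on every component, so taking minima loses nothing. *)
have lab_edge u v : stack_edge C D u v -> stack_label C D v = stack_label C D u.
  have glue x y : [&& overlined x, ~~ overlined y & nabs x == nabs y] ->
      label C x = label D y.
    case/and3P => xb yb /eqP xy; rewrite !label_join xb (negPf yb) label_mirror.
    by congr label; apply: nabs_inj; rewrite // xb /overlined /= yb.
  case: u v => x [] y /=.
  - by move/eqP->; apply: okada_label_arc.
  - by move/glue.
  - by move/glue.
  - by move/eqP->; apply: okada_label_arc.
apply: okada_mul_uniq => // x; last first.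
  have [[u xu <-] _] := label_okada_mul C D x.
  have -> : stack_label C D u = stack_label C D (outer x).
    by move: u xu; apply: connect_ind => // u v xu /lab_edge->.
  by rewrite /outer !label_join; case: ifP => xb /=; rewrite !label_join xb.
have joinC y : connect (stack_edge C D) (inl y) (inl (mate C y)).
  by apply: connect1; rewrite /=.
have joinD y : connect (stack_edge C D) (inr y) (inr (mate D y)).
  by apply: connect1; rewrite /=.
have joinCD y : overlined y -> connect (stack_edge C D) (inl y) (inr (bar y)).
  by move=> yb; apply: connect1;
    rewrite /= yb eqxx /overlined /= -/(overlined y) yb.
have okef b : is_okada (if b then f else e) by case: b.
have okfg b : is_okada (if b then g else mirror f) by case: b.
have okeg b : is_okada (if b then g else e) by case: b.
have eg := etrans ef fg.
have [xb /= mxb|xb _] := boolP (overlined x).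
  have px : ~~ propagating g x.
    have := propagating_join okeg eg x.
    by rewrite /propagating xb -/(join2 e g) mxb => <-.
  rewrite /outer xb mxb {1}/join2 join_stay ?xb //.
  by have := joinD x; rewrite /D {2}/join2 join_stay ?xb.
have [px|px] := boolP (propagating e x); last first.
  rewrite {1}/join2 join_stay (negPf xb) //.
  have mb : overlined (mate e x) = false.
    by move: px; rewrite /propagating negbK (negPf xb) => /eqP.
  rewrite /outer (negPf xb) mb.
  by have := joinC x; rewrite /C {2}/join2 join_stay (negPf xb).
(* A propagating arc of the product has three legs: from [x] to [z] in [C], across to [bar z], and
   on to [w] in [D], all with the same label. *)
have := joinC x; rewrite {2}/C {1}/join2.
case: (joinP okef ef x) => [z _ + pz zl xz|]; last by rewrite (negPf xb) px.
rewrite (negPf xb) /= => zb; rewrite zb (negPf xb) in pz zl.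
have bzb : overlined (bar z) = false
  by rewrite /overlined /= -/(overlined z) zb.
have := joinD (bar z); rewrite {2}/D {1}/join2.
case: (joinP okfg mfg (bar z)) => [w _ + pw wl zw|]; last first.
  by rewrite bzb propagating_mirror barK pz.
rewrite bzb /= => wb; rewrite wb bzb label_mirror barK zl in pw wl.
have -> : mate (join2 e g) x = w.
  by apply: join_uniq; rewrite //= ?(negPf xb) ?wb.
rewrite /outer (negPf xb) wb.
exact: connect_trans xz (connect_trans (joinCD z zb) zw).
Qed.

End Join2.

(** * Green relations *)

Section Green.

Variable N : nat.
Implicit Types (e f C D : diag N) (x : node N).

(** With e' the mirror of e, and e written as e|e: (f|e')(e|e) = f|e, then (f|e)(e'|f) = f|f. *)
Lemma sandwich_mul e f : is_okada e -> is_okada f -> PLab e = PLab f ->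
  okada_mul (okada_mul (join2 f (mirror e)) e) (join2 (mirror e) f) = f.
Proof.
move=> eok fok ef; have meok := okada_mirror eok.
have := join2_mul fok meok eok; rewrite !PLab_mirror mirrorK join2_id //.
move=> -> //.
by rewrite join2_mul // join2_id.
Qed.

Lemma eq_PLab_greenJ e f : is_okada e -> is_okada f -> PLab e = PLab f ->
  greenJ e f.
Proof.
suff sub (u v w : diag N) : is_okada u -> is_okada v -> PLab u = PLab v ->
    two_sided_ideal v w -> two_sided_ideal u w.
  by move=> eok fok ef x; split; apply: sub.
move=> uok vok uv [y [z [yok zok ->]]]; have muok := okada_mirror uok.
pose a := join2 v (mirror u); pose b := join2 (mirror u) v.
have aok : is_okada a by apply: join2_okada; rewrite ?PLab_mirror.
have bok : is_okada b by apply: join2_okada; rewrite ?PLab_mirror.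
exists (okada_mul y a), (okada_mul b z); split; try exact: okada_mul_okada.
rewrite -[in LHS](sandwich_mul uok vok uv) -/a -/b.
by rewrite !okada_mulA //; do ?apply: okada_mul_okada.
Qed.

Lemma mul_label_le C D x :
  label (okada_mul C D) x <= label (if overlined x then D else C) x.
Proof.
have [_ /(_ _ (connect0 _ _))] := label_okada_mul C D x.
by rewrite /outer; case: ifP.
Qed.

(** Such an arc has two outer ends in the same factor, so gluing does not touch it. *)
Lemma mul_mate_stay C D x : is_okada C -> is_okada D ->
  let S := if overlined x then D else C in
  ~~ propagating S x -> mate (okada_mul C D) x = mate S x.
Proof.
move=> Cok Dok S; rewrite /propagating negbK => /eqP xS.
have Sok : is_okada S by rewrite /S; case: ifP.
have [con _] := okada_mul_trace Cok Dok.
have : connect (stack_edge C D) (outer x) (outer (mate S x)).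
  by apply: connect1; rewrite /outer -xS /S; case: ifP => /=.
by rewrite con (negPf (okada_mate_neq Sok x)) => /eqP.
Qed.

Lemma mul_propagating C D x : is_okada C -> is_okada D ->
  propagating (okada_mul C D) x -> propagating (if overlined x then D else C) x.
Proof.
move=> Cok Dok; apply: contraLR => px.
by rewrite {1}/propagating mul_mate_stay.
Qed.

Definition weight D x := propagating D x * label D x.

(* As labels are positive, a non-propagating node weighs strictly less than a
   propagating one: a product that keeps the total weight of a factor keeps all
   of its propagating arcs and their labels. *)
Definition total_weight b D := \sum_(x | overlined x == b) weight D x.

(** A product is controlled on the overlined side by its right factor and on the other side by its
    left factor. Reading each propagating arc at its other end lets the two estimates be chained. *)
Lemma total_weight_side D b : is_okada D ->
  total_weight b D = total_weight (~~ b) D.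
Proof.
move=> Dok; rewrite /total_weight (reindex_inj (can_inj (okada_mateK Dok))) /=.
rewrite big_mkcond [RHS]big_mkcond /=; apply: eq_bigr => x _.
rewrite /weight propagating_mate // okada_label_arc //; move: b.
by rewrite /propagating; case: (overlined x); case: (overlined _) => -[].
Qed.

Lemma mul_weight_le C D x : is_okada C -> is_okada D ->
  weight (okada_mul C D) x <= weight (if overlined x then D else C) x.
Proof.
move=> Cok Dok; rewrite /weight.
case px: (propagating _ x); last by [].
by rewrite (mul_propagating Cok Dok px) !mul1n mul_label_le.
Qed.

Lemma mul_total_weight_le b C D : is_okada C -> is_okada D ->
  total_weight b (okada_mul C D) <= total_weight b (if b then D else C).
Proof.
move=> Cok Dok; apply: leq_sum => x /eqP <-; exact: mul_weight_le.
Qed.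

Lemma PLab_weight b D (l : 'I_N.+1) : is_okada D ->
  reflect (exists2 x, overlined x = b &
    weight D x = l /\ l != ord0) (l \in PLab D).
Proof.
move=> Dok; apply: (iffP idP) => [/(PLab_side Dok b)[x [xb px xl]]|[x _ [xl]]].
  exists x => //; rewrite /weight px mul1n; split=> //.
  by rewrite -val_eqE /= -xl -lt0n; case/andP: (okada_label_le Dok x).
move: xl; rewrite /weight; case px: (propagating D x) => xl l0.
  by apply/mem_PLab; exists x; rewrite // -xl mul1n.
by case/eqP: l0; apply: val_inj.
Qed.

Lemma mul_PLab_eq b C D : is_okada C -> is_okada D ->
  let S := if b then D else C in
  total_weight b S <= total_weight b (okada_mul C D) ->
    PLab (okada_mul C D) = PLab S.
Proof.
move=> Cok Dok S le_S; have CDok := okada_mul_okada Cok Dok.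
have Sok : is_okada S by rewrite /S; case: ifP.
have eq_w x : overlined x = b -> weight (okada_mul C D) x = weight S x.
  move=> xb; have le_w y : overlined y == b ->
      weight (okada_mul C D) y <= weight S y
        ?= iff (weight (okada_mul C D) y == weight S y).
    by move=> /eqP yb; split=> //; rewrite /S -yb mul_weight_le.
  have eqS : total_weight b (okada_mul C D) == total_weight b S.
    by rewrite eqn_leq le_S andbT mul_total_weight_le.
  have := (leqif_sum le_w).2; rewrite [LHS]eqS => /esym/forall_inP/(_ x).
  by rewrite xb eqxx => /(_ isT)/eqP.
apply/setP => l; apply/(PLab_weight b l CDok)/(PLab_weight b l Sok).
  by move=> [x xb xl]; exists x; rewrite // -eq_w.
by move=> [x xb xl]; exists x; rewrite // eq_w.
Qed.

Lemma two_sided_ideal_refl e : is_okada e -> two_sided_ideal e e.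
Proof.
move=> eok; have meok := okada_mirror eok.
exists (join2 e (mirror e)), (join2 (mirror e) e).
by rewrite sandwich_mul //; split=> //; apply: join2_okada;
  rewrite ?PLab_mirror.
Qed.

Lemma greenJ_PLab e f : is_okada e -> is_okada f -> greenJ e f ->
  PLab e = PLab f.
Proof.
move=> eok fok ef.
have [y [z [yok zok def_f]]] : two_sided_ideal e f.
  by apply/ef; apply: two_sided_ideal_refl.
have [y' [z' [y'ok z'ok def_e]]] : two_sided_ideal f e.
  by apply/ef; apply: two_sided_ideal_refl.
have le_w (u v s t : diag N) : is_okada u -> is_okada s -> is_okada t ->
    v = okada_mul (okada_mul s u) t ->
    total_weight false v <= total_weight false (okada_mul s u) /\
    total_weight true (okada_mul s u) <= total_weight true u.
  move=> uok sok tok ->; have suok := okada_mul_okada sok uok.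
  by split; [apply: (@mul_total_weight_le false) | apply:
    (@mul_total_weight_le true)].
(* The weights satisfy w(f) <= w(ye) <= w(e) <= w(y'f) <= w(f), so all are equal, and [PLab] is the
   same for f, ye and e. *)
have [f1 f2] := le_w e f y z eok yok zok def_f.
have [e1 e2] := le_w f e y' z' fok y'ok z'ok def_e.
have yeok := okada_mul_okada yok eok; have y'fok := okada_mul_okada y'ok fok.
rewrite (total_weight_side true yeok) (total_weight_side true eok) /= in f2.
rewrite (total_weight_side true y'fok) (total_weight_side true fok) /= in e2.
have := @mul_PLab_eq false _ _ yeok zok; rewrite -def_f /= => ->; last by lia.
apply/esym/(@mul_PLab_eq true _ _ yok eok).
by rewrite (total_weight_side true yeok) (total_weight_side true eok) /=; lia.
Qed.

(** By symmetry [bar (mate e x)] is a propagating node on the side of [x] with the label of [x], and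
    propagating labels are distinct on each side. *)
Lemma involutive_propagating e x : is_okada e -> involutive_diag e ->
  propagating e x -> mate e x = bar x.
Proof.
move=> eok inv px; apply/(can_inj (@barK N)); rewrite barK.
have mbar y : mate e (bar y) = bar (mate e y).
  by rewrite [in LHS]inv mate_mirror barK.
have lbar y : label e (bar y) = label e y.
  by rewrite [in LHS]inv label_mirror barK.
apply/esym/(propagating_label_inj eok) => //.
- by rewrite /propagating mbar (okada_mateK eok); move: px;
  rewrite /propagating /overlined /= ; do 2!case: (_.1).
- by move: px; rewrite /propagating /overlined /=; do 2!case: (_.1).
- by rewrite lbar (okada_label_arc eok).
Qed.

Lemma involutive_eq e f : is_okada e -> is_okada f ->
  involutive_diag e -> involutive_diag f ->
  (forall x, ~~ overlined x -> mate e x = mate f x /\ label e x = label f x) ->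
    e = f.
Proof.
move=> eok fok einv finv top; apply: eq_diag => x.
  have [xb|/top[] //] := boolP (overlined x).
  rewrite einv finv !mate_mirror; congr bar.
  by have [|] := top (bar x); rewrite // /overlined /= negbK.
have [xb|/top[] //] := boolP (overlined x).
rewrite einv finv !label_mirror.
by have [|] := top (bar x); rewrite // /overlined /= negbK.
Qed.

Lemma right_ideal_refl e : is_okada e -> right_ideal e e.
Proof.
move=> eok; have meok := okada_mirror eok; exists (join2 (mirror e) e).
  by apply: join2_okada; rewrite ?PLab_mirror.
by rewrite -[X in okada_mul X](join2_id eok) join2_mul // join2_id.
Qed.

(** Each of the two is a right multiple of the other, so the labels of the upper halves bound each
    other, and an upper arc that does not propagate in one occurs in the other. The remaining arcs
    propagate in both and are vertical. *)
Lemma greenR_involutive_eq e f : is_okada e -> is_okada f -> greenR e f ->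
  involutive_diag e -> involutive_diag f -> e = f.
Proof.
move=> eok fok ef einv finv.
have [z zok def_f] : right_ideal e f by apply/ef; apply: right_ideal_refl.
have [y yok def_e] : right_ideal f e by apply/ef; apply: right_ideal_refl.
apply: involutive_eq => // x /negPf xb.
have le_fe : label f x <= label e x.
  by rewrite {1}def_f; have := mul_label_le e z x; rewrite xb.
have le_ef : label e x <= label f x.
  by rewrite {1}def_e; have := mul_label_le f y x; rewrite xb.
split; last by apply/eqP; rewrite eqn_leq le_ef.
have [pe|pe] := boolP (propagating e x); last first.
  by rewrite [in RHS]def_f mul_mate_stay ?xb.
have [pf|pf] := boolP (propagating f x); last first.
  by rewrite [in LHS]def_e mul_mate_stay ?xb.
by rewrite !involutive_propagating.
Qed.

Lemma greenR_mul e f y z : is_okada e -> is_okada f -> is_okada y ->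
  is_okada z ->
  f = okada_mul e y -> e = okada_mul f z -> greenR e f.
Proof.
move=> eok fok yok zok def_f def_e x; split=> -[t tok ->].
  exists (okada_mul z t); first exact: okada_mul_okada.
  by rewrite okada_mulA // -def_e.
exists (okada_mul y t); first exact: okada_mul_okada.
by rewrite okada_mulA // -def_f.
Qed.

Lemma greenR_involutive e : is_okada e ->
  exists! f, [/\ is_okada f, greenR e f & involutive_diag f].
Proof.
move=> eok; have meok := okada_mirror eok.
have me : PLab e = PLab (mirror e) by rewrite PLab_mirror.
pose f := join2 e (mirror e); have fok : is_okada f by apply: join2_okada.
have ef : greenR e f.
  apply: (greenR_mul eok fok meok eok).
    have := join2_mul eok eok meok erefl me.
    by rewrite !join2_id.
  by have := join2_mul eok meok eok me (esym me); rewrite mirrorK join2_id.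
have inv : involutive_diag f.
  by rewrite /involutive_diag /f mirror_join2 // mirrorK.
exists f; split=> // g [gok eg ginv]; apply: greenR_involutive_eq => // y.
by rewrite -ef.
Qed.

End Green.

(** * Products of commuting generators *)

(* Closed form of the product of the commuting [okada_gen N i], [s i]; the arcs
   {i, i+1} have label [i], all labels being as large as the bound allows. *)
Definition pairing_diag N (s : pred nat) : diag N :=
  ([ffun x : node N =>
      if s (nabs x) then (x.1, insubd x.2 (nabs x))
      else if s (nabs x).-1 then (x.1, insubd x.2 (nabs x).-2)
      else bar x],
   [ffun x : node N => if s (nabs x).-1 then (nabs x).-1 else nabs x]).

Definition sparse N (s : pred nat) := forall i, s i -> 0 < i < N /\ ~~ s i.+1.

Section PairingDiag.

Variable N : nat.
Implicit Types (s t : pred nat) (x y z : node N).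

Lemma eq_pairing_diag s t : s =1 t -> pairing_diag N s = pairing_diag N t.
Proof. by move=> st; congr (_, _); apply/ffunP => x; rewrite !ffunE !st. Qed.

Lemma okada_gen_pairing i : 0 < i -> okada_gen N i = pairing_diag N (pred1 i).
Proof.
move=> i0; have eqS x : ((nabs x).-1 == i) = (nabs x == i.+1) by rewrite /nabs;
  lia.
have predE j : pred1 i j = (j == i) by [].
congr (_, _); apply/ffunP => x; rewrite !ffunE !predE eqS.
  by case: eqP => [->|_] //; case: eqP => [->|].
by case: eqP => [->|].
Qed.

Lemma okada_one_pairing : okada_one N = pairing_diag N pred0.
Proof. by congr (_, _); apply/ffunP => x; rewrite !ffunE. Qed.

Variant pairing_spec s x : node N -> nat -> Prop :=
| PairingUp y of s (nabs x) & ~~ s (nabs x).-1 & overlined y = overlined x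
    & nabs y = (nabs x).+1 : pairing_spec s x y (nabs x)
| PairingDown y of s (nabs x).-1 & ~~ s (nabs x) & overlined y = overlined x
    & nabs y = (nabs x).-1 & 1 < nabs x : pairing_spec s x y (nabs x).-1
| PairingFlat of ~~ s (nabs x) & ~~ s (nabs x).-1 :
  pairing_spec s x (bar x) (nabs x).

Lemma pairingP s x : sparse N s ->
  pairing_spec s x (mate (pairing_diag N s) x) (label (pairing_diag N s) x).
Proof.
move=> sp; rewrite [mate _ x]ffunE [label _ x]ffunE.
case: ifPn => sx.
  have [/andP[_ ltN] _] := sp _ sx; have sx' : ~~ s (nabs x).-1.
    by apply: contraL sx => /sp[_]; rewrite prednK.
  by rewrite (negPf sx'); apply: PairingUp; rewrite // /nabs val_insubd ltN.
case: ifPn => sx'; last exact: PairingFlat.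
have [/andP[x0 ltN] _] := sp _ sx'; apply: PairingDown => //.
have lt2 : (nabs x).-2 < N by lia.
by rewrite {1}/nabs val_insubd lt2 prednK.
Qed.

Lemma between_adjacent x y z : overlined y = overlined x ->
  nabs y = (nabs x).+1 ->
  between (pos x) (pos z) (pos y) = false.
Proof.
rewrite !nabsE => ->; rewrite /between overlinedE.
by have := pos_lt x; have := pos_lt y; case: ifP; lia.
Qed.

Lemma between_bar x z : between (pos x) (pos z) (pos (bar x)) =
  (nabs x < nabs z).
Proof.
have [zx|zx] := eqVneq (overlined z) (overlined x).
  by rewrite between_opposite_sides // /overlined /=; case: (_.1).
rewrite betweenC (@between_opposite_sides _ (bar x)) //.
  by rewrite /overlined /=; case: (_.1).
by move: zx; rewrite /overlined /=; do 2!case: (_.1).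
Qed.

Lemma pairing_okada s : sparse N s -> is_okada (pairing_diag N s).
Proof.
move=> sp; have sP x := pairingP x sp.
apply: planar_okada => [|x]; last first.
  by have : 0 < nabs x by []; case: (sP x) => [y|y _ _ _ _|]; lia.
split.
- by move=> x y _ _; apply: pos_inj.
- by move=> x _; rewrite inE.
- move=> x _; case: (sP x) => [y _ _ _ yx|y _ _ _ yx x1|_ _].
  + by apply: contra_eq_neq yx => ->; lia.
  + by apply: contra_eq_neq yx => ->; lia.
  + by case: (x) => [[] i].
- move=> x _; case: (sP x) => [y sx sx' oyx yx|y sx' sx oyx yx x1|sx sx'].
  + case: (sP y) => [z sy _ _ _|z _ _ ozy zy _|_].
    * by have [_] := sp _ sx; rewrite -yx sy.
    * by apply: nabs_inj; rewrite ?ozy // zy yx.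
    * by rewrite yx /= sx.
  + case: (sP y) => [z _ _ ozy zy|z _ |].
    * by apply: nabs_inj; rewrite ?ozy // zy yx; lia.
    * by rewrite yx sx'.
    * by rewrite yx sx'.
  + case: (sP (bar x)) => [y|y|_ _];
    [by rewrite (negPf sx) | by rewrite (negPf sx')|].
    exact: barK.
- move=> x _; case: (sP x) => [y sx sx' oyx yx|y sx' sx oyx yx x1|sx sx'].
  + case: (sP y) => [z sy _ _ _|z _ _ ozy zy _|_].
    * by have [_] := sp _ sx; rewrite -yx sy.
    * by rewrite yx.
    * by rewrite yx /= sx.
  + by case: (sP y) => [z _ _ ozy zy|z _|]; rewrite yx ?sx'.
  + case: (sP (bar x)) => [y sb _ _ _|y sb _ _ _ _|_ _] //.
    by case/negP: sx'.
- move=> a c _ _; case: (sP a) => [y _ _ ya eya|y _ _ ya eya a1|sa sa'] ca cma.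
  + by rewrite !between_adjacent.
  + by rewrite !(betweenC (pos a)) !between_adjacent // eya; lia.
  + rewrite !between_bar; case: (sP c) => [z sc _ _ zc|z sc' sc _ zc c1|_ _] //.
      by have : nabs a != nabs c by [apply: contraNneq sa => ->]; rewrite zc;
        lia.
    by have : nabs a != (nabs c).-1 by [apply: contraNneq sa => ->]; rewrite zc;
      lia.
- move=> a c _ _; case: (sP a) => [y _ _ ya eya|y _ _ ya eya a1|sa sa'].
  + by rewrite between_adjacent.
  + by rewrite (betweenC (pos a)) between_adjacent // eya; lia.
  + rewrite between_bar; case: (sP c) => [z sc _ _ zc|z sc' sc _ zc c1|_ _] //.
    move=> lt; suff: nabs a != (nabs c).-1 by lia.
    by apply: contraNneq sa => ->.
- move=> x _; case: (sP x) => [y _ _ yx|y _ _ yx|_ _].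
  + move: yx; rewrite !nabsE; have := pos_lt x; have := pos_lt y.
    move=> lty ltx ->; rewrite overlinedE; case: (leqP N (pos x)) => leN eqxy.
      by rewrite ltnNge (_ : pos y <= pos x) ?addn0 ?oddB ?odd_double //; lia.
    by rewrite (_ : pos x < pos y) ?addn1 //; lia.
  + move: yx; rewrite !nabsE; have := pos_lt x; have := pos_lt y.
    move=> lty ltx ->; rewrite overlinedE;
      case: (leqP N (pos x)) => leN eqxy x1.
      by rewrite (_ : pos x < pos y) ?addn1 /= -?subnS ?oddB ?odd_double //=;
        lia.
    by rewrite ltnNge (_ : pos y <= pos x) ?addn0 //; lia.
  + rewrite lt_pos_opposite; last by rewrite /overlined /=; case: (_.1).
    rewrite nabsE; case: ifP => _ /=; last by rewrite addn1.
    by rewrite oddB ?odd_double ?addn0 // ltnW ?pos_lt.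
Qed.

Section PairingMul.

Variables s1 s2 : pred nat.
Local Notation t := (predU s1 s2).
Hypothesis tsp : sparse N t.

Lemma sparse_predUl : sparse N s1.
Proof.
move=> i si; have [|] := tsp (i := i); rewrite /= ?si // negb_or.
by move=> -> /andP[].
Qed.

Lemma sparse_predUr : sparse N s2.
Proof.
move=> i si; have [|] := tsp (i := i); rewrite /= ?si ?orbT // negb_or.
by move=> -> /andP[].
Qed.

Lemma mate_flat s x : sparse N s -> ~~ s (nabs x) -> ~~ s (nabs x).-1 ->
  mate (pairing_diag N s) x = bar x.
Proof. by move=> sp /negPf sx /negPf sx'; case: (pairingP x sp);
  rewrite ?sx ?sx'. Qed.

Lemma mate_up s x y : sparse N s -> s (nabs x) -> overlined y = overlined x ->
  nabs y = (nabs x).+1 -> mate (pairing_diag N s) x = y.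
Proof.
move=> sp sx yx eyx; case: (pairingP x sp) => [z _ _ zx ezx|z _|];
  rewrite ?sx //.
by apply: nabs_inj; rewrite ?zx // ezx.
Qed.

Lemma pairing_mul : okada_mul (pairing_diag N s1) (pairing_diag N s2) =
  pairing_diag N t.
Proof.
have sp1 := sparse_predUl; have sp2 := sparse_predUr.
have [ok1 ok2 ok] := And3 (pairing_okada sp1) (pairing_okada sp2)
  (pairing_okada tsp).
set C := pairing_diag N s1 in ok1 *; set D := pairing_diag N s2 in ok2 *.
have csym : connect_sym (stack_edge C D) by
  apply/sym_connect_sym/stack_edge_sym.
have con1 x : connect (stack_edge C D) (inl x) (inl (mate C x)).
  by apply: connect1; rewrite /=.
have con2 x : connect (stack_edge C D) (inr x) (inr (mate D x)).
  by apply: connect1; rewrite /=.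
have glue x y : overlined x -> ~~ overlined y -> nabs x = nabs y ->
    connect (stack_edge C D) (inl x) (inr y).
  by move=> xb yb xy; apply: connect1; rewrite /= xb yb xy eqxx.
have ovbar x : overlined (bar x) = ~~ overlined x by [].
have flat1 x : ~~ s1 (nabs x) -> ~~ s1 (nabs x).-1 ->
    connect (stack_edge C D) (inl x) (inl (bar x)).
  by move=> sx sx'; have := con1 x; rewrite /C mate_flat.
have flat2 x : ~~ s2 (nabs x) -> ~~ s2 (nabs x).-1 ->
    connect (stack_edge C D) (inr x) (inr (bar x)).
  by move=> sx sx'; have := con2 x; rewrite /D mate_flat.
(* Either the factor containing the outer nodes has this arc, or it is vertical there and the path
   passes through the arc of the other factor and comes back. *)
have up x y : t (nabs x) -> ~~ t (nabs x).-1 -> overlined y = overlined x ->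
    nabs y = (nabs x).+1 -> connect (stack_edge C D) (outer x) (outer y).
  move=> tx; have [_] := tsp tx; rewrite /= !negb_or.
  move=> /andP[s1y s2y] /andP[s1x s2x] yx eyx.
  have up1 z w : s1 (nabs x) -> nabs z = nabs x -> nabs w = (nabs x).+1 ->
      overlined w = overlined z -> connect (stack_edge C D) (inl z) (inl w).
    move=> sx ez ew wz; have := con1 z; rewrite /C (@mate_up _ _ w) ?ez //.
  have up2 z w : s2 (nabs x) -> nabs z = nabs x -> nabs w = (nabs x).+1 ->
      overlined w = overlined z -> connect (stack_edge C D) (inr z) (inr w).
    move=> sx ez ew wz; have := con2 z; rewrite /D (@mate_up _ _ w) ?ez //.
  have ovy : overlined (bar y) = ~~ overlined x by rewrite ovbar yx.
  rewrite /outer yx; case: ifPn => xb.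
  - have [s2x0|s2x0] := boolP (s2 (nabs x)); first exact: up2.
    have s1x0 : s1 (nabs x) by move: tx; rewrite /= (negPf s2x0) orbF.
    apply: connect_trans (flat2 x _ _) _ => //.
    apply: connect_trans (_ : connect _ _ (inl x)) _.
      by rewrite csym; apply: glue; rewrite // ovbar xb.
    apply: connect_trans (up1 x y _ _ _ _) _ => //.
    apply: connect_trans (glue y (bar y) _ _ _) _; rewrite ?ovy ?yx ?xb //.
    by rewrite csym; apply: flat2; rewrite eyx.
  - have [s1x0|s1x0] := boolP (s1 (nabs x)); first exact: up1.
    have s2x0 : s2 (nabs x) by move: tx; rewrite /= (negPf s1x0).
    apply: connect_trans (flat1 x _ _) _ => //.
    apply: connect_trans (glue (bar x) x _ _ _) _ => //.
    apply: connect_trans (up2 x y _ _ _ _) _ => //.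
    apply: connect_trans (_ : connect _ _ (inl (bar y))) _.
      by rewrite csym; apply: glue; rewrite // ?ovy ?yx // xb.
    by rewrite csym; apply: flat1; rewrite eyx.
have con x : ~~ overlined x || overlined (mate (pairing_diag N t) x) ->
    connect (stack_edge C D) (outer x) (outer (mate (pairing_diag N t) x)).
  case: (pairingP x tsp) => [y tx tx' yx eyx|y tx' tx yx eyx x1|tx tx'] xb.
  - exact: up.
  - have tx'' : ~~ t (nabs x).-2.
      by apply: contraL tx' => /tsp[_]; rewrite prednK.
    by rewrite csym; apply: up; rewrite ?eyx.
  - have {}xb : overlined x = false.
      by apply/negbTE; move: xb; rewrite ovbar orbb.
    rewrite /outer ovbar xb /=; move: tx tx'; rewrite /= !negb_or.
    move=> /andP[s1x s2x] /andP[s1x' s2x'].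
    apply: connect_trans (flat1 x _ _) _ => //.
    apply: connect_trans (glue (bar x) x _ _ _) _; rewrite ?ovbar ?xb //.
    exact: flat2.
(* The least level of the block [{i, i + 1}] of [t] containing [a], or [a] itself. It is constant
   along the stack and bounds all labels from below, which gives one half of the label
   computation. *)
pose block a := if t a.-1 then a.-1 else a.
have block_mate s z : sparse N s -> (forall i, s i -> t i) ->
    block (nabs (mate (pairing_diag N s) z)) = block (nabs z).
  move=> sp st; rewrite /block;
    case: (pairingP z sp) => [w sz _ _ ->|w sz' _ _ -> z1|] //.
  - have tz := st _ sz.
    have /negPf-> : ~~ t (nabs z).-1.
      by apply: contraL tz => /tsp[_]; rewrite prednK.
    by rewrite /= in tz *; rewrite tz.
  - have tz' := st _ sz'; rewrite [in RHS]tz'.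
    have /negPf-> // : ~~ t (nabs z).-2.
    by apply: contraL tz' => /tsp[_]; rewrite prednK.
have block_label s z : sparse N s -> (forall i, s i -> t i) ->
    block (nabs z) <= label (pairing_diag N s) z.
  move=> sp st; rewrite /block.
  case: (pairingP z sp) => [w sz _ _ _|w sz' _ _ _ _|_ _].
  - by case: ifP => _; rewrite ?leq_pred.
  - by rewrite (st _ sz').
  - by case: ifP => _; rewrite ?leq_pred.
have st1 i : s1 i -> t i by move=> /= ->.
have st2 i : s2 i -> t i by move=> /= ->; rewrite orbT.
pose ublock (u : stack_node N) :=
  match u with inl z | inr z => block (nabs z) end.
have ublock_edge u v : stack_edge C D u v -> ublock v = ublock u.
  case: u v => z [] w /=; try by case/and3P => _ _ /eqP->.
    by move/eqP->; apply: block_mate.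
  by move/eqP->; apply: block_mate.
have ublock_le u : ublock u <= stack_label C D u
  by case: u => z; apply: block_label.
have block_E x : block (nabs x) = label (pairing_diag N t) x.
  rewrite /block; case: (pairingP x tsp) =>
    [y _ /negPf-> //|y -> //|_ /negPf-> //].
apply: okada_mul_uniq => // x;
have [[u xu lab_u] minx] := label_okada_mul C D x.
apply/eqP; rewrite eqn_leq; apply/andP; split; last first.
  have ub : ublock u = block (nabs x).
    have -> : block (nabs x) = ublock (outer x) by rewrite /outer; case: ifP.
    by move: u xu {lab_u}; apply: connect_ind => // v w <- /ublock_edge.
  by rewrite -block_E -ub -lab_u.
(* The other half: the label bound applies at each outer node of the component, in particular at the
   one of least level. *)
have le_nabs y : connect (stack_edge C D) (outer x) (outer y) ->
    label (okada_mul C D) x <= nabs y.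
  move/minx/leq_trans; apply; rewrite /outer; case: ifP => _ /=.
    by case/andP: (okada_label_le ok2 y).
  by case/andP: (okada_label_le ok1 y).
have := con x; case: (pairingP x tsp) => [y _ _ _ _ _|y _ _ -> <- _ xy|_ _ _].
- exact: le_nabs.
- by apply/le_nabs/xy; rewrite orNb.
- exact: le_nabs.
Qed.

End PairingMul.

Lemma big_okada_gen (r : seq nat) : sparse N (mem r) ->
  \big[@okada_mul N/okada_one N]_(i <- r) okada_gen N i =
    pairing_diag N (mem r).
Proof.
elim: r => [|i r IHr] sp; first by rewrite big_nil okada_one_pairing.
have sp' : sparse N (predU (pred1 i) (mem r)).
  by move=> j rj; have [|] := sp j; rewrite /= inE.
rewrite big_cons IHr; last exact: (sparse_predUr sp').
rewrite okada_gen_pairing; last by have [|/andP[]] := sp i;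
  rewrite /= ?mem_head.
by rewrite pairing_mul //; apply: eq_pairing_diag => j; rewrite /= inE.
Qed.

Lemma PLab_pairing s (l : 'I_N.+1) : sparse N s ->
  (l \in PLab (pairing_diag N s)) = [&& l != ord0, ~~ s l & ~~ s l.-1].
Proof.
move=> sp; apply/mem_PLab/and3P => [[x px xl]|[l0 sl sl']].
  move: px xl; rewrite /propagating.
  case: (pairingP x sp) => [y _ _ ->|y _ _ ->|sx sx' _ xl]; rewrite ?eqxx //.
  by rewrite -xl; split; rewrite // -val_eqE /= -xl.
have l1N : l.-1 < N by move: l0; rewrite -val_eqE /=; have := ltn_ord l; lia.
pose x : node N := (false, Ordinal l1N).
have xl : nabs x = l by rewrite /nabs /= prednK // lt0n; apply: l0.
rewrite -xl in sl sl'; exists x; first by rewrite /propagating mate_flat.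
by case: (pairingP x sp); rewrite ?(negPf sl) ?(negPf sl').
Qed.

End PairingDiag.

(** * Fibonacci sets *)

Section Fibonacci.

Variable N : nat.
Implicit Types (S : {set 'I_N.+1}).

Definition rank_in S i := #|[set s in S | s <= i]|.

Lemma rank_in_nth S k : k < #|S| -> rank_in S (nth ord0 (enum S) k) = k.+1.
Proof.
move=> ltk; pose r := [seq val s | s <- enum S].
have szr : size r = #|S| by rewrite size_map cardE.
have r_sorted : sorted ltn r.
  rewrite sorted_map /enum_mem.
  apply: (sorted_filter (leT := relpre val ltn)) => [j i l /=|];
    first exact: ltn_trans.
  by rewrite -enumT -sorted_map val_enum_ord iota_ltn_sorted.
have -> : nth ord0 (enum S) k = nth 0 r k :> nat.
  by rewrite (nth_map ord0) // -cardE.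
have := @Order.PreorderTheory.count_le_nth _ nat 0 r k r_sorted.
rewrite szr => /(_ ltk) <-;
  rewrite /rank_in /r count_map -sum1_count big_enum_cond -sum1_card.
by apply: eq_bigl => s; rewrite inE.
Qed.

(** Counting elements up to a bound replaces indices in [enum S]; unlike an index, the count can be
    followed by induction on the bound. *)
Lemma fibonacciP S : fibonacci_set S <->
  [/\ ord0 \notin S, odd #|S| = odd N
    & {in S, forall l : 'I_N.+1, odd l = odd (rank_in S l)}].
Proof.
have oddP m n : m = n %[mod 2] <-> odd m = odd n.
  by rewrite !modn2; split=> [|->] //; do 2!case: odd.
split=> -[S0 cardS ranks]; split=> //; try exact/oddP.
- move=> l lS;
  have ltk : index l (enum S) < #|S| by rewrite cardE index_mem mem_enum.
  have := ranks _ ltk; have := rank_in_nth ltk.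
  by rewrite nth_index ?mem_enum // => -> /oddP.
- move=> k ltk; apply/oddP; rewrite ranks ?rank_in_nth //.
  by rewrite -mem_enum mem_nth // -cardE.
Qed.

Section Frak.

Variable S : {set 'I_N.+1}.
Hypothesis Sfib : fibonacci_set S.

Definition last_in i := \max_(s in S | s <= i) s.

Definition inS i := [exists s in S, s == i :> nat].

Lemma inSP (l : 'I_N.+1) : inS l = (l \in S).
Proof.
apply/exists_inP/idP => [[s sS /eqP/val_inj <-] //|lS]; by exists l.
Qed.

Lemma last_in_le i : last_in i <= i.
Proof. by apply/bigmax_leqP => s /andP[]. Qed.

Lemma last_in_id i : inS i -> last_in i = i.
Proof.
case/exists_inP => s sS /eqP si; apply/eqP; rewrite eqn_leq last_in_le /=.
by rewrite -{1}si; apply: leq_bigmax_cond; rewrite sS si /=.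
Qed.

Lemma le_succ s i : s \in S -> ~~ inS i.+1 -> (s <= i.+1) = (s <= i).
Proof.
move=> sS Si; rewrite leq_eqVlt ltnS; case: eqP => // si.
by case/exists_inP: Si; exists s => //; apply/eqP.
Qed.

Lemma last_in_step i : ~~ inS i.+1 -> last_in i.+1 = last_in i.
Proof.
move=> Si; apply: eq_bigl => s; case sS: (s \in S) => //=; exact: le_succ.
Qed.

Lemma rank_in_step i : rank_in S i.+1 = rank_in S i + inS i.+1.
Proof.
have [/exists_inP[s sS /eqP si]|Si] := boolP (inS i.+1); last first.
  rewrite addn0; apply: eq_card => s; rewrite !inE.
  by case sS: (s \in S) => //=; apply: le_succ.
rewrite addn1 /rank_in (cardsD1 s) inE sS si leqnn /= add1n; congr _.+1.
apply: eq_card => u; rewrite !inE -val_eqE /= si.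
by case: (u \in S) => /=; lia.
Qed.

(** The largest element of [S] up to [i] has rank [rank_in S i]; if there is none, both sides
    concern 0. *)
Lemma odd_last_in i : i <= N -> odd (last_in i) = odd (rank_in S i).
Proof.
have [S0 _ ranks] := (fibonacciP S).1 Sfib.
elim: i => [_|i IHi leiN].
  have -> : last_in 0 = 0 by apply/eqP; rewrite -leqn0 last_in_le.
  rewrite [rank_in S 0](_ : _ = 0) //; apply/eqP; rewrite cards_eq0.
  apply/set0Pn => -[s].
  rewrite inE leqn0 => /andP[sS /eqP s0]; case/negP: S0.
  by rewrite -(_ : s = ord0) //; apply: val_inj.
have [/[dup] Si /exists_inP[s sS /eqP si]|Si] := boolP (inS i.+1).
  by rewrite last_in_id // -{1}si ranks // si.
by rewrite last_in_step // rank_in_step (negPf Si) addn0 IHi // ltnW.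
Qed.

(** Evenly many integers separate consecutive elements of [S], so they split into adjacent pairs and
    the integer just before an element of [S] starts no pair. [odd_last_in_N] says the same about
    the end of the interval, using the parity of the cardinal. *)
Lemma odd_inS i : i < N -> inS i.+1 -> odd (last_in i) = odd i.
Proof.
move=> ltiN Si; have := odd_last_in ltiN; rewrite last_in_id // rank_in_step Si.
by rewrite odd_last_in 1?ltnW // addn1 /= => /negb_inj.
Qed.

Lemma odd_last_in_N : odd (last_in N) = odd N.
Proof.
have [_ <- _] := (fibonacciP S).1 Sfib; rewrite odd_last_in //; congr (odd _).
by apply: eq_card => s; rewrite !inE -ltnS ltn_ord andbT.
Qed.

Lemma mem_frakF i : (i \in frakF S) = (0 < i <= N) && odd (i - last_in i).
Proof. by rewrite mem_filter mem_iota add1n ltnS andbC. Qed.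

Lemma sparse_frakF : sparse N (mem (frakF S)).
Proof.
move=> i; rewrite /= !mem_frakF => /andP[/andP[i0 leiN] odd_i].
have ltiN : i < N.
  rewrite ltn_neqAle leiN andbT; apply: contraTneq odd_i => ->.
  by rewrite oddB ?last_in_le // odd_last_in_N addbb.
rewrite i0 ltiN; split=> //=.
have [Si|Si] := boolP (inS i.+1); first by rewrite last_in_id // subnn.
by rewrite last_in_step // subSn ?last_in_le //= odd_i.
Qed.

(** If [l] is not in [S], then [l] and [l.-1] have the same last element of [S] before them, so
    exactly one of the two differences is odd and [l] lies in a pair. *)
Lemma PLab_frakF : PLab (pairing_diag N (mem (frakF S))) = S.
Proof.
have [S0 _ _] := (fibonacciP S).1 Sfib.
apply/setP => l; rewrite PLab_pairing; last exact: sparse_frakF.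
rewrite /= !mem_frakF -inSP.
have [->|l0] := eqVneq l ord0; first by rewrite inSP (negPf S0).
have def_l : (l : nat).-1.+1 = l by rewrite prednK // lt0n; apply: l0.
have ltl : l.-1 < N by rewrite def_l -ltnS.
rewrite /= -def_l /= ltl (ltnW ltl) /= andbT.
have [Sl|Sl] := boolP (inS l.-1.+1).
  rewrite last_in_id // subnn /= negb_and; apply/orP; right.
  by rewrite oddB ?last_in_le // odd_inS // addbb.
rewrite last_in_step // subSn ?last_in_le //= negbK.
by case: (posnP l.-1) => [->|_] /=; rewrite ?sub0n //; case: odd.
Qed.

Lemma free_eltE : free_elt S = pairing_diag N (mem (frakF S)).
Proof. exact/big_okada_gen/sparse_frakF. Qed.

End Frak.
End Fibonacci.

(** * Propagating label sets are Fibonacci sets *)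

Section PLabFibonacci.
Variables (N : nat) (e : diag N).
Hypothesis eok : is_okada e.

(** The non-propagating nodes among the first [k] are matched with each other. Taking [k = N] gives
    the parity of the cardinal, and [k = nabs x] the parity of a rank. *)
Lemma odd_card_propagating k : k <= N ->
  (forall y, ~~ propagating e y -> pos y < k -> pos (mate e y) < k) ->
  odd #|[set y : node N | (pos y < k) && propagating e y]| = odd k.
Proof.
move=> lekN stable;
have le2N : k <= N.*2 by rewrite -addnn (leq_trans lekN) ?leq_addr.
rewrite -[in RHS](card_pos_lt le2N) -[in RHS](cardsID [set y | propagating e y])
  oddD.
rewrite [X in _ (+) X]negbTE ?addbF.
  by congr (odd _); apply: eq_card => y; rewrite !inE.
apply: (card_involution_even (f := mate e)) => y; rewrite !inE => /andP[py lty].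
by rewrite propagating_mate // py stable // okada_mateK // okada_mate_neq.
Qed.

Lemma PLab_fibonacci : fibonacci_set (PLab e).
Proof.
have topE (y : node N) k : k <= N -> pos y < k -> overlined y = false.
  by rewrite overlinedE; lia.
pose f y : 'I_N.+1 := Ordinal (label_leN eok y : label e y < N.+1).
have f_inj : {in [pred y | propagating e y && ~~ overlined y] &, injective f}.
  move=> y z /andP[py /negPf yb] /andP[pz /negPf zb] [eq_l].
  by apply: (propagating_label_inj eok) => //; rewrite yb zb.
have imf k : k <= N ->
    #|f @: [set y : node N | (pos y < k) && propagating e y]| =
    #|[set y : node N | (pos y < k) && propagating e y]|.
  move=> lek; apply: card_in_imset => y z;
    rewrite !inE => /andP[yk py] /andP[zk pz].
  by apply: f_inj; rewrite inE ?py ?pz (topE _ _ lek).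
apply/fibonacciP; split.
- apply/negP => /mem_PLab[x _ x0].
  by have := okada_label_le eok x; rewrite x0.
- rewrite -(@odd_card_propagating N) // => [|y]; last first.
    by rewrite /propagating negbK !overlinedE; lia.
  rewrite -imf //; congr (odd #|pred_of_set _|); apply/setP => l.
  apply/idP/imsetP => [/(PLab_side eok false)[x [xb px xl]]|[x + ->]].
    exists x; last exact: val_inj.
    by rewrite inE px andbT; move: xb; rewrite overlinedE; lia.
  by rewrite inE => /andP[_ px]; apply/mem_PLab; exists x.
- move=> l /(PLab_side eok false)[x [xb px xl]].
  have top_nabs (y : node N) : overlined y = false -> nabs y = (pos y).+1.
    by rewrite nabsE => ->.
  have lexN : nabs x <= N by apply: ltn_ord.
  (* The label has the parity of the left end counted from 1, which here is [nabs x]; it remains to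
     compare [nabs x] with the rank of [l]. *)
  have odd_l : odd l = odd (nabs x).
    rewrite -xl (planar_parity (okada_planar eok)) ?inE // lt_pos_opposite;
      last first.
      by rewrite eq_sym.
    by rewrite xb addn1 top_nabs.
  rewrite odd_l -(odd_card_propagating lexN); last first.
    (* A non-propagating node to the left of [x] has its mate to the left of [x] too, as their arc
       cannot cross the propagating arc at [x]. *)
    move=> y py lty; have yb := topE _ _ lexN lty.
    have yx : y != x by apply: contraNneq py => ->.
    have ymx : y != mate e x
      by apply: contraNneq py => ->; rewrite propagating_mate.
    have myb : overlined (mate e y) = false.
      by move: py; rewrite /propagating negbK yb => /eqP.
    have mxb : overlined (mate e x) != overlined x by rewrite eq_sym.
    have := planar_cross (okada_planar eok) (in_setT x) (in_setT y) yx ymx.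
    rewrite !(between_opposite_sides mxb) ?yb ?myb ?xb //.
    rewrite (top_nabs x) // (top_nabs y) // (top_nabs _ myb) in lty *.
    by move: (pos_neq yx); lia.
  rewrite -imf //; congr (odd #|pred_of_set _|); apply/setP => s.
  rewrite inE; apply/imsetP/andP =>
    [[y + ->]|[/(PLab_side eok false)[y [yb py ys]] sl]].
    rewrite inE => /andP[yx py]; have yb := topE _ _ lexN yx.
    split; first by apply/mem_PLab; exists y.
    rewrite /= -xl leqNgt (propagating_label_lt eok) ?yb ?xb // -leqNgt.
    by rewrite (top_nabs y).
  exists y; last exact: val_inj.
  rewrite inE py andbT -(top_nabs y) //.
  by rewrite leqNgt -(propagating_label_lt eok) ?yb ?xb // -leqNgt ys xl.
Qed.

End PLabFibonacci.

(** * Free representatives of the J-classes *)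

Lemma free_elt_spec (N : nat) (S : {set 'I_N.+1}) : fibonacci_set S ->
  [/\ is_okada (free_elt S), is_free (free_elt S) & PLab (free_elt S) = S].
Proof.
move=> Sfib; split; last by rewrite free_eltE ?PLab_frakF.
  by rewrite free_eltE //; apply/pairing_okada/sparse_frakF.
by exists S.
Qed.

Theorem theorem5p11 (N : nat) (hN : 1 <= N) :
  [/\ forall e : diag N, is_okada e ->
        exists! f : diag N, [/\ is_okada f, greenR e f & involutive_diag f],
      forall e : diag N, is_okada e ->
        exists! f : diag N, [/\ is_okada f, greenJ e f & is_free f]
    & forall e f : diag N, is_okada e -> is_okada f ->
        (greenJ e f /\ is_free f <-> is_free f /\ PLab f = PLab e)].
Proof.
split=> [e eok|e eok|e f eok fok]; first exact: greenR_involutive.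
- have [fok ffree fe] := free_elt_spec (PLab_fibonacci eok).
  exists (free_elt (PLab e)); split=> [|g [gok eg [S Sfib def_g]]].
    by split=> //; apply: eq_PLab_greenJ.
  have [_ _ PLabS] := free_elt_spec Sfib.
  by rewrite (greenJ_PLab eok gok eg) def_g PLabS.
- split=> [[ef ffree]|[ffree fe]]; split=> //.
    exact/esym/greenJ_PLab.
  exact: eq_PLab_greenJ.
Qed.
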